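(* Let $(M,d)$ be a complete metric space with more than one element and with a distinguished point $0\in M$. Then the Lipschitz-free space $\mathcal F(M)$ is locally almost square if and only if $M$ is a length space.
   Context: All Banach spaces are real. Lipschitz-free space: for a metric space $(M,d)$ with a distinguished point $0\in M$, $\operatorname{Lip}_0(M)$ is the Banach space of all Lipschitz functions $f\colon M\to\mathbb R$ with $f(0)=0$, with norm $\|f\|=\sup\{|f(p)-f(q)|/d(p,q)\colon p,q\in M,\ p\neq q\}$. For $p\in M$ let $\delta_p\in\operatorname{Lip}_0(M)^*$ be given by $\delta_p(f)=f(p)$. The Lipschitz-free space is $\mathcal F(M)=\overline{\operatorname{span}}\{\delta_p\colon p\in M\}\subset\operatorname{Lip}_0(M)^*$, with the norm inherited from $\operatorname{Lip}_0(M)^*$. Length space: a metric space $(M,d)$ is a length space if for every pair of different points $p,q\in M$, the distance $d(p,q)$ equals the infimum of the lengths of rectifiable simple (i.e. injective) paths joining them. (A path from $p$ to $q$ is a continuous map $\gamma\colon[\alpha,\beta]\to M$ with $\gamma(\alpha)=p$, $\gamma(\beta)=q$; its length is $L(\gamma)=\sup\{\sum_{i=0}^{n-1}d(\gamma(t_i),\gamma(t_{i+1}))\colon n\in\mathbb N,\ \alpha=t_0\le\dots\le t_n=\beta\}$, and $\gamma$ is rectifiable if $L(\gamma)<\infty$.) Locally almost square: a Banach space $X$ with unit sphere $S_X$ is locally almost square if for every $\varepsilon>0$ and every $x\in S_X$ there exists $y\in S_X$ such that $\|x+y\|\le 1+\varepsilon$ and $\|x-y\|\le 1+\varepsilon$.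 *)

(* Defs.v *)
From HB Require Import structures.
From mathcomp Require Import all_boot all_order all_algebra.
From mathcomp Require Import all_classical all_reals all_analysis.

Set Implicit Arguments.
Unset Strict Implicit.
Unset Printing Implicit Defensive.

Import Order.TTheory GRing.Theory Num.Theory.
Import numFieldNormedType.Exports.

Local Open Scope classical_set_scope.
Local Open Scope ring_scope.

Section SupBound.
Variable R : realType.

Lemma sup_le_bound (A : set R) (c : R) :
  0 <= c -> (forall x, A x -> x <= c) -> sup A <= c.
Proof.
move=> c0 Ac; have [->|/set0P A0] := eqVneq A set0; first by rewrite sup0.
exact: ge_sup.
Qed.

Lemma sup_bound_ge0 (A : set R) : (forall x, A x -> 0 <= x) -> 0 <= sup A.
Proof.
move=> A0; have [sA|sA] := pselect (has_sup A); last by rewrite sup_out.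
have [[x Ax] _] := sA.
by rewrite (le_trans (A0 _ Ax))//; apply: ub_le_sup => //; exact: sA.2.
Qed.

Lemma le_sup_bound (A : set R) (c x : R) :
  (forall y, A y -> y <= c) -> A x -> x <= sup A.
Proof. by move=> Ac Ax; apply: ub_le_sup => //; exists c => y; exact: Ac. Qed.

End SupBound.

Section Lip0.
Variables (R : realType) (M : metricType R) (x0 : M).

Definition lip0_pred : {pred M -> R^o} := mem [set f : M -> R^o | f x0 = 0 /\
  exists L : R, forall p q, `|f p - f q| <= L * mdist p q].

Lemma lip0_submod_closed : submod_closed lip0_pred.
Proof.
split.
  rewrite inE /=; split=> //; exists 0 => p q.
  by rewrite /= subrr normr0 mul0r.
move=> a f g; rewrite !inE /= => -[f0 [L HL]] [g0 [K HK]]; split.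
  have -> : (a *: f + g) x0 = a *: f x0 + g x0 by [].
  by rewrite f0 g0 scaler0 addr0.
exists (`|a| * L + K) => p q.
have -> : (a *: f + g) p - (a *: f + g) q
    = (a *: f p + g p) - (a *: f q + g q) by [].
rewrite opprD addrACA -scalerBr mulrDl.
apply: le_trans (ler_normD _ _) _; apply: lerD; last exact: HK.
by rewrite normrZ -mulrA ler_wpM2l.
Qed.

HB.instance Definition _ := GRing.isSubmodClosed.Build _ _ lip0_pred
  lip0_submod_closed.

Definition lip0 : Type := {f : M -> R^o | f \in lip0_pred}.
HB.instance Definition _ := SubChoice.on lip0.
HB.instance Definition _ := [SubChoice_isSubLmodule of lip0 by <:].

Definition lip0_fun (f : lip0) : M -> R := val f.
Coercion lip0_fun : lip0 >-> Funclass.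

Definition lip_quotients (f : M -> R) : set R :=
  [set z | exists p q : M, p <> q /\ z = `|f p - f q| / mdist p q].

Definition lip_norm (f : lip0) : R := sup (lip_quotients f).

Lemma lip0_at0 (f : lip0) : f x0 = 0.
Proof. by have /set_mem[] := valP f. Qed.

Lemma lip0_bound (f : lip0) :
  exists L : R, forall z, lip_quotients f z -> z <= L.
Proof.
have /set_mem[_ [L HL]] := valP f; exists L => _ [p [q [pq ->]]].
by rewrite ler_pdivrMr ?HL// mdist_gt0; exact/eqP.
Qed.

Lemma lip_normP (f : lip0) p q : `|f p - f q| <= lip_norm f * mdist p q.
Proof.
have [->|pq] := eqVneq p q; first by rewrite subrr normr0 mdistxx mulr0.
rewrite -ler_pdivrMr ?mdist_gt0//; have [L HL] := lip0_bound f.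
by apply: (le_sup_bound HL); exists p, q; split=> //; exact/eqP.
Qed.

Lemma lip_norm_ge0 (f : lip0) : 0 <= lip_norm f.
Proof. by apply: sup_bound_ge0 => _ [p [q [_ ->]]]; rewrite divr_ge0// mdist_ge0. Qed.

Lemma lip_norm_le (f : lip0) (c : R) : 0 <= c ->
  (forall p q, `|f p - f q| <= c * mdist p q) -> lip_norm f <= c.
Proof.
move=> c0 fc; apply: sup_le_bound => // _ [p [q [/eqP pq ->]]].
by rewrite ler_pdivrMr ?mdist_gt0.
Qed.

Lemma lip_normD (f g : lip0) : lip_norm (f + g) <= lip_norm f + lip_norm g.
Proof.
apply: lip_norm_le => [|p q]; first by rewrite addr_ge0 ?lip_norm_ge0.
have -> : (f + g : lip0) p - (f + g : lip0) q = (f p - f q) + (g p - g q).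
  by rewrite opprD addrACA.
by rewrite mulrDl (le_trans (ler_normD _ _))// lerD ?lip_normP.
Qed.

Lemma lip_normZ_le (a : R) (f : lip0) :
  lip_norm (a *: f) <= `|a| * lip_norm f.
Proof.
apply: lip_norm_le => [|p q]; first by rewrite mulr_ge0 ?lip_norm_ge0.
have -> : (a *: f : lip0) p - (a *: f : lip0) q = a * (f p - f q) by rewrite mulrBr.
by rewrite normrM -mulrA ler_wpM2l ?lip_normP.
Qed.

Lemma lip_normZ (a : R) (f : lip0) : lip_norm (a *: f) = `|a| * lip_norm f.
Proof.
apply/eqP; rewrite eq_le lip_normZ_le /=.
have [->|a0] := eqVneq a 0; first by rewrite normr0 mul0r lip_norm_ge0.
have := lip_normZ_le a^-1 (a *: f).
by rewrite scalerA mulVf// scale1r normfV ler_pdivlMl// normr_gt0.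
Qed.

Lemma lip_norm0_eq0 (f : lip0) : lip_norm f = 0 -> f = 0.
Proof.
move=> f0; apply/val_inj/funext => p.
have := lip_normP f p x0; rewrite f0 mul0r lip0_at0 subr0 normr_le0.
by move=> /eqP.
Qed.

HB.instance Definition _ :=
  @Lmodule_isNormed.Build R lip0 lip_norm lip_normD lip_normZ lip_norm0_eq0.

End Lip0.

Section Dual.
Variables (R : realType) (V : normedModType R).

Definition dual_pred : {pred V -> R^o} :=
  mem [set phi : V -> R^o | linear phi /\ continuous phi].

Lemma dual_submod_closed : submod_closed dual_pred.
Proof.
split.
  rewrite inE /=; split; last exact: cst_continuous.
  by move=> a u v; rewrite /= scaler0 addr0.
move=> a f g; rewrite !inE /= => -[lf cf] [lg cg]; split.
  move=> b u v.
  have E w : (a *: f + g) w = a *: f w + g w by [].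
  rewrite !E lf lg !scalerDr !scalerA [a * b]mulrC.
  by rewrite addrACA.
by move=> v; apply: cvgD; [apply: cvgZl_tmp; exact: cf|exact: cg].
Qed.

HB.instance Definition _ := GRing.isSubmodClosed.Build _ _ dual_pred
  dual_submod_closed.

Definition dual : Type := {phi : V -> R^o | phi \in dual_pred}.
HB.instance Definition _ := SubChoice.on dual.
HB.instance Definition _ := [SubChoice_isSubLmodule of dual by <:].

Definition dual_fun (phi : dual) : V -> R := val phi.
Coercion dual_fun : dual >-> Funclass.

Definition dual_norm (phi : dual) : R :=
  sup [set `|phi v| | v in [set v : V | `|v| <= 1]].

Lemma dual_linear (phi : dual) (a : R) u v :
  phi (a *: u + v) = a * phi u + phi v.
Proof. by have /set_mem[+ _] := valP phi; exact. Qed.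

Lemma dual0 (phi : dual) : phi 0 = 0.
Proof.
have := dual_linear phi (-1) 0 0.
by rewrite scaler0 addr0 mulN1r addNr.
Qed.

Lemma dualZ (phi : dual) (a : R) v : phi (a *: v) = a * phi v.
Proof. by have := dual_linear phi a v 0; rewrite !addr0 dual0 addr0. Qed.

Lemma dual_bound (phi : dual) :
  exists2 L : R, 0 <= L & forall v : V, `|phi v| <= L * `|v|.
Proof.
have /set_mem[_ /(_ 0)] := valP phi.
move=> /cvgrPdist_le /(_ 1 ltr01) /nbhs_normP[/= e e0 He].
exists (2 / e) => [|v]; first by rewrite divr_ge0// ltW.
have [->|v0] := eqVneq v 0; first by rewrite dual0 !normr0 mulr0.
have nv : 0 < `|v| by rewrite normr_gt0.
pose c := e / 2 / `|v|; have c0 : 0 < c by rewrite !divr_gt0.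
have := He (c *: v); rewrite /ball_ /= sub0r normrN normrZ gtr0_norm//.
rewrite divfK ?gt_eqF// => /(_ _)/wrap[].
  by rewrite ltr_pdivrMr// ltr_pMr// ltr1n.
have -> : val phi 0 = 0 by exact: dual0.
have -> : val phi (c *: v) = c * phi v by exact: dualZ.
rewrite sub0r normrN normrM gtr0_norm// -ler_pdivlMl// mulr1.
by rewrite /c !invf_div [leRHS]mulrC.
Qed.

Lemma dual_norm_ge0 (phi : dual) : 0 <= dual_norm phi.
Proof. by apply: sup_bound_ge0 => _ [v _ <-]. Qed.

Lemma dual_norm_le (phi : dual) (c : R) : 0 <= c ->
  (forall v : V, `|v| <= 1 -> `|phi v| <= c) -> dual_norm phi <= c.
Proof. by move=> c0 fc; apply: sup_le_bound => // _ [v v1 <-]; exact: fc. Qed.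

Lemma dual_normP1 (phi : dual) (v : V) : `|v| <= 1 -> `|phi v| <= dual_norm phi.
Proof.
move=> v1; have [L L0 HL] := dual_bound phi.
apply: (@le_sup_bound _ _ L) => [_ [u /= u1 <-]|]; last by exists v.
by rewrite (le_trans (HL _))// ler_piMr.
Qed.

Lemma dual_normP (phi : dual) (v : V) : `|phi v| <= dual_norm phi * `|v|.
Proof.
have [->|v0] := eqVneq v 0; first by rewrite dual0 !normr0 mulr0.
have nv : 0 < `|v| by rewrite normr_gt0.
rewrite -ler_pdivrMr// -[in leLHS](gtr0_norm nv) -normfV -normrM mulrC -dualZ.
by apply: dual_normP1; rewrite normrZ normfV normr_id mulVf// gt_eqF.
Qed.

Lemma dual_normD (f g : dual) : dual_norm (f + g) <= dual_norm f + dual_norm g.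
Proof.
apply: dual_norm_le => [|v v1]; first by rewrite addr_ge0 ?dual_norm_ge0.
by rewrite (le_trans (ler_normD _ _))// lerD ?dual_normP1.
Qed.

Lemma dual_normZ_le (a : R) (f : dual) :
  dual_norm (a *: f) <= `|a| * dual_norm f.
Proof.
apply: dual_norm_le => [|v v1]; first by rewrite mulr_ge0 ?dual_norm_ge0.
have -> : (a *: f : dual) v = a * f v by [].
by rewrite normrM ler_wpM2l ?dual_normP1.
Qed.

Lemma dual_normZ (a : R) (f : dual) : dual_norm (a *: f) = `|a| * dual_norm f.
Proof.
apply/eqP; rewrite eq_le dual_normZ_le /=.
have [->|a0] := eqVneq a 0; first by rewrite normr0 mul0r dual_norm_ge0.
have := dual_normZ_le a^-1 (a *: f).
by rewrite scalerA mulVf// scale1r normfV ler_pdivlMl// normr_gt0.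
Qed.

Lemma dual_norm0_eq0 (f : dual) : dual_norm f = 0 -> f = 0.
Proof.
move=> f0; apply/val_inj/funext => v.
by have := dual_normP f v; rewrite f0 mul0r normr_le0 => /eqP.
Qed.

HB.instance Definition _ :=
  @Lmodule_isNormed.Build R dual dual_norm dual_normD dual_normZ dual_norm0_eq0.

Lemma bounded_linear_dual (f : V -> R^o) (C : R) : linear f ->
  (forall v, `|f v| <= C * `|v|) -> f \in dual_pred.
Proof.
move=> lf Cf; rewrite inE /=; split=> // v.
have fB u w : f u - f w = f (u - w).
  by have := lf (-1) w u; rewrite !scaleN1r ![- _ + _]addrC => ->.
apply/cvgrPdist_lt => e e0; near=> w.
rewrite fB (le_lt_trans (Cf _))//.
have K0 : 0 < `|C| + 1 by rewrite ltr_wpDl.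
apply: (@le_lt_trans _ _ ((`|C| + 1) * `|v - w|)).
  by rewrite ler_wpM2r// (le_trans (ler_norm _))// lerDl.
rewrite -ltr_pdivlMl// mulrC; near: w.
by apply: cvgr_dist_lt; [exact: cvg_id|rewrite divr_gt0].
Unshelve. all: by end_near. Qed.

Lemma dual_complete (F : set_system dual) :
  ProperFilter F -> cauchy F -> cvg F.
Proof.
move=> FF /cauchyP Fc.
have Fe e : 0 < e -> exists phi : dual, F [set psi : dual | `|phi - psi| < e].
  move=> e0; have [phi Fphi] := Fc _ e0; exists phi.
  by rewrite -ball_normE in Fphi.
have dualB (phi psi : dual) v : `|phi v - psi v| <= `|phi - psi| * `|v|.
  exact: (dual_normP (phi - psi) v).
have Fv v : cvg ((fun phi : dual => phi v : R^o) @ F).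
  apply: cauchy_cvg; apply: cauchy_exP => e e0.
  have K0 : 0 < `|v| + 1 by rewrite ltr_wpDl.
  have [phi Fphi] := Fe _ (divr_gt0 e0 K0).
  exists (phi v).
  change (F [set psi : dual | ball (phi v : R^o) e (psi v)]).
  apply: filterS Fphi => psi /= phipsi.
  suff : `|phi v - psi v| < e by rewrite -ball_normE.
  rewrite (le_lt_trans (dualB _ _ _))//.
  rewrite (@le_lt_trans _ _ (`|phi - psi| * (`|v| + 1)))//.
    by rewrite ler_wpM2l// lerDl.
  by rewrite -ltr_pdivlMr.
pose l v : R^o := lim ((fun phi : dual => phi v : R^o) @ F).
have ll : linear l.
  move=> a u v.
  have : (fun phi : dual => phi (a *: u + v) : R^o) @ F --> a *: l u + l v.
    rewrite (_ : (fun phi : dual => _) =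
      (fun phi : dual => a *: (phi u : R^o) + (phi v : R^o))).
      by apply: cvgD; [apply: cvgZl_tmp|]; exact: Fv.
    by apply/funext => phi; rewrite dual_linear.
  by move=> /cvg_lim <-.
have lP (phi : dual) e : F [set psi : dual | `|phi - psi| < e] ->
    forall v, `|phi v - l v| <= e * `|v|.
  move=> Fphi v; apply/ler_addgt0Pr => d d0.
  have /cvgrPdist_lt /(_ _ d0) Fl := Fv v.
  have [psi [h1 h2]] := filter_ex (filterI Fphi Fl).
  rewrite -(subrKA (psi v)) (le_trans (ler_normD _ _))// lerD//.
    by rewrite (le_trans (dualB _ _ _))// ler_wpM2r// ltW.
  by rewrite distrC ltW.
have [phi0 /lP phi0l] := Fe _ ltr01.
have lD : (l : V -> R^o) \in dual_pred.
  apply: (@bounded_linear_dual _ (dual_norm phi0 + 1)) => // v.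
  rewrite -(subrK (phi0 v) (l v)) addrC mulrDl.
  rewrite (le_trans (ler_normD _ _))// lerD ?dual_normP//.
  by rewrite distrC phi0l.
pose L : dual := exist _ l lD.
apply/cvg_ex; exists L; apply/fcvgrPdist_lt => e e0.
have e2 : 0 < e / 2 by rewrite divr_gt0.
have [phi Fphi] := Fe _ e2.
have phiL : `|phi - L| <= e / 2.
  apply: dual_norm_le => [|v v1]; first exact: ltW.
  rewrite (le_trans (lP _ _ Fphi v))//.
  by rewrite ler_piMr// ltW.
apply: filterS Fphi => psi phipsi.
rewrite -(subrKA phi) (le_lt_trans (ler_normD _ _))// [ltRHS]splitr.
by rewrite ler_ltD// distrC.
Qed.

HB.instance Definition _ := Uniform_isComplete.Build dual dual_complete.

End Dual.

Section ClosedSpan.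
Variables (R : realType) (V : completeNormedModType R) (A : set V).

Definition lin_span : set V := [set v | exists n (c : 'I_n -> R) (a : 'I_n -> V),
  (forall i, A (a i)) /\ v = \sum_(i < n) c i *: a i].

Definition closed_span_pred : {pred V} := mem (closure lin_span).

Lemma lin_span_linear (b : R) u v :
  lin_span u -> lin_span v -> lin_span (b *: u + v).
Proof.
move=> [n [c [a [Aa ->]]]] [m [d [a' [Aa' ->]]]].
exists (n + m)%N.
exists (fun i => match fintype.split i with inl j => b * c j | inr j => d j end).
exists (fun i => match fintype.split i with inl j => a j | inr j => a' j end).
split=> [i|]; first by case: (fintype.split i).
rewrite big_split_ord /= scaler_sumr; congr (_ + _); apply: eq_bigr => i _.
  by rewrite (unsplitK (inl i)) scalerA.
by rewrite (unsplitK (inr i)).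
Qed.

Lemma closure_normP (B : set V) (x : V) :
  closure B x <-> forall e : R, 0 < e -> exists2 y, B y & `|x - y| < e.
Proof.
split=> [Bx e e0|Bx U /nbhs_normP[e /= e0 eU]].
  have [y [By xy]] := Bx _ (nbhsx_ballx x _ e0).
  by exists y => //; rewrite -ball_normE in xy.
have [y By xy] := Bx _ e0.
by exists y; split=> //; exact: eU.
Qed.

Lemma closed_span_submod_closed : submod_closed closed_span_pred.
Proof.
split.
  rewrite inE; apply: subset_closure.
  by exists 0, (fun=> 0), (fun=> 0); split=> [[]//|]; rewrite big_ord0.
move=> a u v; rewrite !inE => /closure_normP Hu /closure_normP Hv.
apply/closure_normP => e e0.
have K0 : 0 < `|a| + 1 by rewrite ltr_wpDl.
have e2 : 0 < e / 2 by rewrite divr_gt0.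
have [u' Su' uu'] := Hu _ (divr_gt0 e2 K0).
have [v' Sv' vv'] := Hv _ e2.
exists (a *: u' + v'); first exact: lin_span_linear.
rewrite opprD addrACA -scalerBr (le_lt_trans (ler_normD _ _))// [ltRHS]splitr.
rewrite ler_ltD// normrZ (@le_trans _ _ ((`|a| + 1) * `|u - u'|))//.
  by rewrite ler_wpM2r// lerDl.
by rewrite -ler_pdivlMl// mulrC ltW.
Qed.

HB.instance Definition _ := GRing.isSubmodClosed.Build _ _ closed_span_pred
  closed_span_submod_closed.

Definition closed_span : Type := {v : V | v \in closed_span_pred}.
HB.instance Definition _ := SubChoice.on closed_span.
HB.instance Definition _ := [SubChoice_isSubLmodule of closed_span by <:].

Definition closed_span_norm (v : closed_span) : R := `|val v|.

Lemma closed_span_normD (u v : closed_span) :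
  closed_span_norm (u + v) <= closed_span_norm u + closed_span_norm v.
Proof. exact: ler_normD. Qed.

Lemma closed_span_normZ (a : R) (v : closed_span) :
  closed_span_norm (a *: v) = `|a| * closed_span_norm v.
Proof. exact: normrZ. Qed.

Lemma closed_span_norm0_eq0 (v : closed_span) : closed_span_norm v = 0 -> v = 0.
Proof. by move=> /normr0_eq0 v0; exact: val_inj. Qed.

HB.instance Definition _ := @Lmodule_isNormed.Build R closed_span
  closed_span_norm closed_span_normD closed_span_normZ closed_span_norm0_eq0.

Lemma closed_span_complete (F : set_system closed_span) :
  ProperFilter F -> cauchy F -> cvg F.
Proof.
move=> FF /cauchyP Fc.
have Gc : cvg ((fun x : closed_span => val x) @ F).
  apply: cauchy_cvg; apply: cauchy_exP => e e0.
  have [x Fx] := Fc _ e0; exists (val x).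
  change (F [set y : closed_span | ball (val x) e (val y)]).
  by apply: filterS Fx => y; rewrite -!ball_normE.
pose v : V := lim ((fun x : closed_span => val x) @ F).
have Gv e : 0 < e -> F [set x : closed_span | `|v - val x| < e].
  by move=> e0; have /cvgrPdist_lt /(_ _ e0) := Gc.
have vS : v \in closed_span_pred.
  rewrite inE /=.
  have := @closed_closure _ lin_span; apply; apply/closure_normP => e /Gv Fe.
  have [x vx] := filter_ex Fe; exists (val x) => //.
  by have /set_mem := valP x.
apply/cvg_ex; exists (exist _ v vS : closed_span).
by apply/fcvgrPdist_lt => e /Gv.
Qed.

HB.instance Definition _ := Uniform_isComplete.Build closed_span
  closed_span_complete.

End ClosedSpan.

Section FreeSpace.
Variables (R : realType) (M : metricType R) (x0 : M).

Definition delta_fun (p : M) (f : lip0 x0) : R^o := f p.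

Lemma delta_fun_dual (p : M) : delta_fun p \in @dual_pred R (lip0 x0).
Proof.
apply: (@bounded_linear_dual _ _ _ (mdist p x0)) => // f.
by have := lip_normP f p x0; rewrite lip0_at0 subr0 mulrC.
Qed.

Definition delta (p : M) : dual (lip0 x0) :=
  exist _ (delta_fun p) (delta_fun_dual p).

Definition free_space : completeNormedModType R := closed_span (range delta).

End FreeSpace.

Definition locally_almost_square (R : realType) (X : completeNormedModType R) :=
  forall (e : R) (x : X), 0 < e -> `|x| = 1 ->
    exists y : X, [/\ `|y| = 1, `|x + y| <= 1 + e & `|x - y| <= 1 + e].

Section LengthSpace.
Variables (R : realType) (M : metricType R).

Definition path_length (a b : R) (g : R -> M) : \bar R :=
  ereal_sup [set s | exists (n : nat) (t : nat -> R),
    [/\ t 0 = a, t n = b, forall i, (i < n)%N -> t i <= t i.+1 &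
        s = (\sum_(i < n) mdist (g (t i)) (g (t i.+1)))%:E]].

(* Only the restriction of g to the segment [a, b] matters. *)
Definition path_between (p q : M) (a b : R) (g : R -> M) : Prop :=
  [/\ a <= b, {within `[a, b], continuous g}, g a = p & g b = q].

Definition simple_path (a b : R) (g : R -> M) : Prop :=
  {in `[a, b] &, injective g}.

Definition length_space : Prop := forall p q : M, p <> q ->
  (mdist p q)%:E = ereal_inf [set l | exists (a b : R) (g : R -> M),
    [/\ path_between p q a b g, simple_path a b g,
        (path_length a b g < +oo)%E & l = path_length a b g]].

End LengthSpace.

(* The library's complete uniform spaces carry a designated point of their own;
   this is their completeness axiom without that structure. *)
Definition complete_metric (R : realType) (M : metricType R) : Prop :=
  forall F : set_system M, ProperFilter F -> cauchy F -> exists p : M, F --> p.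

(* Main.v *)
(** If F(M) is locally almost square, apply the property to the molecule of a
    nearly shortest pair (p, q) that cannot be joined by chains of steps at most s
    and of total length close to d(p, q). Discounting every step that does not
    go almost directly from p to q gives a 1-Lipschitz cost f that still nearly
    norms the molecule, and a norming function g of the companion y is almost
    constant on {p, q}; then f + t g violates the bound on the norm of x + y.
    Chains give approximate midpoints, hence by completeness almost optimal
    Lipschitz curves, and one of minimal Lipschitz constant in a compact set is
    injective.

    Conversely, by Kantorovich duality a norm-one x is close to a combination of
    molecules of total weight close to 1. Walk along an almost geodesic path for
    each molecule and let y be the sum of the small steps with signs that make a
    1-Lipschitz function oscillate near 0. The signs are balanced, so for every
    1-Lipschitz g the sum |x(g)| + |y(g)| exceeds the total weight only slightly. *)

Require Import Defs.
From mathcomp Require Import all_boot all_order all_algebra.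
From mathcomp Require Import all_classical all_reals all_analysis.
From mathcomp Require Import ring lra.

Set Implicit Arguments.
Unset Strict Implicit.
Unset Printing Implicit Defensive.

Import Order.TTheory GRing.Theory Num.Theory.
Import numFieldNormedType.Exports.

Local Open Scope classical_set_scope.
Local Open Scope ring_scope.

(** * The Hahn-Banach theorem for sublinear functionals *)

Section HahnBanach.
Variables (R : realType) (V : lmodType R).
Implicit Types (p q : V -> R) (u v : V).

Definition sublinear p :=
  (forall u v, p (u + v) <= p u + p v) /\
  (forall a v, 0 <= a -> p (a *: v) <= a * p v).

Lemma sublinear0 p : sublinear p -> p 0 = 0.
Proof.
move=> [pD pZ]; have := pZ 0 0 (lexx _); have := pD 0 0.
rewrite addr0 scaler0 mul0r; lra.
Qed.

Lemma sublinearZ p a v : sublinear p -> 0 <= a -> p (a *: v) = a * p v.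
Proof.
move=> sp a_ge0; apply/eqP; rewrite eq_le sp.2//=.
move: a_ge0; rewrite [0 <= a]le_eqVlt => /predU1P[<-|a0].
  by rewrite scale0r mul0r sublinear0.
have a'0 : 0 <= a^-1 by rewrite invr_ge0 ltW.
have := sp.2 _ (a *: v) a'0.
by rewrite scalerA mulVf ?gt_eqF// scale1r ler_pdivlMl.
Qed.

Lemma sublinearN p v : sublinear p -> - p (- v) <= p v.
Proof.
move=> sp; have := sp.1 v (- v); rewrite subrr sublinear0//; lra.
Qed.

Lemma le_inf_elt (A : set R) (m x : R) :
  (forall y, A y -> m <= y) -> A x -> inf A <= x.
Proof. by move=> Am Ax; apply: ge_inf => //; exists m => y; exact: Am. Qed.

(* A sublinear minorant of [p] that is additive in the direction [e]: a minimal
   sublinear functional equals all its shifts, hence is linear. *)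
Definition sublinear_shift p e v : R :=
  inf [set r | exists2 t, 0 <= t & r = p (v + t *: e) - t * p e].

Lemma sublinear_shift_le p e v t : sublinear p -> 0 <= t ->
  sublinear_shift p e v <= p (v + t *: e) - t * p e.
Proof.
move=> sp t0; apply: (@le_inf_elt _ (- p (- v))); last by exists t.
move=> _ [s s0 ->].
have h1 := sp.1 (v + s *: e) (- v).
rewrite addrAC subrr add0r in h1.
by have := sublinearZ e sp s0; lra.
Qed.

Lemma sublinear_shift_sub p e : sublinear p -> sublinear (sublinear_shift p e).
Proof.
move=> sp; have ne v : [set r | exists2 t, 0 <= t &
    r = p (v + t *: e) - t * p e] !=set0.
  by exists (p (v + 0 *: e) - 0 * p e); exists 0.
split=> [u v|a v].
  rewrite -lerBlDr; apply: lb_le_inf => // _ [t t0 ->].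
  rewrite lerBlDr -lerBlDl; apply: lb_le_inf => // _ [s s0 ->].
  have := sublinear_shift_le e (u + v) sp (addr_ge0 t0 s0).
  have := sp.1 (u + t *: e) (v + s *: e).
  by rewrite addrACA -scalerDl; lra.
rewrite [0 <= a]le_eqVlt => /predU1P[<-|a0].
  rewrite scale0r mul0r (le_trans (sublinear_shift_le e 0 sp (lexx _)))//.
  by rewrite scale0r addr0 mul0r subr0 sublinear0.
rewrite -ler_pdivrMl//; apply: lb_le_inf => // _ [t t0 ->].
rewrite ler_pdivrMl//.
have := sublinear_shift_le e (a *: v) sp (mulr_ge0 (ltW a0) t0).
have := sp.2 a (v + t *: e) (ltW a0).
by rewrite scalerDr scalerA; lra.
Qed.

(** Zorn's lemma for the reversed pointwise order. The infimum of a chain is finite because every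
    sublinear [p] below [q] satisfies [- q (- v) <= p v], and it is subadditive because two members
    of a chain are comparable. *)
Lemma minimal_sublinear q : sublinear q ->
  exists p, [/\ sublinear p, forall v, p v <= q v &
    forall p', sublinear p' -> (forall v, p' v <= p v) -> p' = p].
Proof.
move=> sq.
pose T := {p : V -> R | sublinear p /\ forall v, p v <= q v}.
pose below (s t : T) := `[< forall v, sval t v <= sval s v >].
have Tq : T by exists q; split.
have [||||[p [sp pq]] pmin] := @Zorn T below.
- by move=> t; apply/asboolP.
- by move=> r s t /asboolP rs /asboolP st; apply/asboolP => v; exact: le_trans (st v) (rs v).
- move=> [s Hs] [t Ht] /asboolP/= st /asboolP/= ts.
  have E : s = t by apply/funext => v; apply/eqP; rewrite eq_le st ts.
  by move: Hs Ht; rewrite E => Hs Ht; congr exist; exact: Prop_irrelevance.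
- move=> A tA; have [A0|/set0P[a0 Aa0]] := eqVneq A set0.
    by exists Tq => s; rewrite A0.
  pose B v := [set r | exists2 t, A t & r = sval t v].
  have Bne v : B v !=set0 by exists (sval a0 v), a0.
  have Ble t v : A t -> inf (B v) <= sval t v.
    move=> At; apply: (@le_inf_elt _ (- q (- v))); last by exists t.
    move=> _ [[s [ss sq']] _ ->] /=.
    by apply: le_trans (sublinearN v ss); rewrite lerN2.
  have sB : sublinear (fun v => inf (B v)).
    split=> [u v|a v a_ge0].
      rewrite -lerBlDr; apply: lb_le_inf => // _ [t At ->].
      rewrite lerBlDr -lerBlDl; apply: lb_le_inf => // _ [s As ->].
      rewrite lerBlDl; have [/asboolP ts|/asboolP st] := tA t s At As.
        rewrite (le_trans (Ble _ _ As))// (le_trans ((svalP s).1.1 _ _))//.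
        by rewrite lerD2r.
      rewrite (le_trans (Ble _ _ At))// (le_trans ((svalP t).1.1 _ _))//.
      by rewrite lerD2l.
    move: a_ge0; rewrite [0 <= a]le_eqVlt => /predU1P[<-|a_gt0].
      by rewrite (le_trans (Ble _ _ Aa0))// scale0r mul0r sublinear0//; exact: (svalP a0).1.
    rewrite -ler_pdivrMl//; apply: lb_le_inf => // _ [t At ->].
    rewrite ler_pdivrMl// (le_trans (Ble _ _ At))//.
    by apply: (svalP t).1.2; exact: ltW.
  have Bq v : inf (B v) <= q v.
    by rewrite (le_trans (Ble _ _ Aa0))//; exact: (svalP a0).2.
  exists (exist _ (fun v => inf (B v)) (conj sB Bq)) => s As.
  by apply/asboolP => v /=; exact: Ble.
exists p; split=> // p' sp' p'p.
have p'q v : p' v <= q v by exact: le_trans (p'p v) (pq v).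
have /(_ _)/(congr1 sval)/= := pmin (exist _ p' (conj sp' p'q)).
by apply; apply/asboolP.
Qed.

Lemma hahn_banach q (v0 : V) : sublinear q -> exists l : V -> R,
  [/\ forall u v, l (u + v) = l u + l v, forall a v, l (a *: v) = a * l v,
      forall v, l v <= q v & l v0 = q v0].
Proof.
move=> sq.
(* Minimising below the shift of [q] along [v0], rather than below [q] itself, yields
   [l (- v0) <= - q v0], hence [l v0 = q v0] at the end. *)
have [l [sl lq lmin]] := minimal_sublinear (sublinear_shift_sub v0 sq).
have lD u v : l (u + v) = l u + l v.
  (* By minimality [l] equals its shift along [v]; time 1 in the shift then gives
     [l u <= l (u + v) - l v]. *)
  have E := lmin _ (sublinear_shift_sub v sl).
  have /E lE : forall w, sublinear_shift l v w <= l w.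
    move=> w; have := sublinear_shift_le v w sl (lexx _).
    by rewrite scale0r addr0 mul0r subr0.
  apply/eqP; rewrite eq_le sl.1/= -{1}lE.
  by have := sublinear_shift_le v u sl ler01; rewrite scale1r; lra.
have lN v : l (- v) = - l v.
  by apply/eqP; rewrite -addr_eq0 -lD addNr sublinear0.
have lZ0 a v : 0 <= a -> l (a *: v) = a * l v.
  move=> a0; have h1 := sl.2 a v a0; have := sl.2 a (- v) a0.
  by rewrite scalerN !lN; lra.
have lqv v : l v <= q v.
  rewrite (le_trans (lq v))// (le_trans (sublinear_shift_le v0 v sq (lexx _)))//.
  by rewrite scale0r addr0 mul0r subr0.
exists l; split=> //.
  move=> a v; case: (lerP 0 a) => [/lZ0//|a0].
  by apply: oppr_inj; rewrite -lN -scaleNr lZ0 ?mulNr// oppr_ge0 ltW.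
apply/eqP; rewrite eq_le lqv/=.
have := lq (- v0); have := sublinear_shift_le v0 (- v0) sq ler01.
by rewrite scale1r addNr sublinear0// lN; lra.
Qed.

End HahnBanach.

(** * 1-Lipschitz functions and McShane extension *)

Section Lipschitz1.
Variables (R : realType) (M : metricType R).
Implicit Types (f g : M -> R) (x y : M).

Definition lip1 f := forall x y, f x - f y <= mdist x y.

Lemma lip1_norm f x y : lip1 f -> `|f x - f y| <= mdist x y.
Proof.
by move=> lf; rewrite ler_norml lf andbT; have := lf y x; rewrite metric_sym; lra.
Qed.

Lemma lip1_max f g : lip1 f -> lip1 g -> lip1 (fun x => Num.max (f x) (g x)).
Proof.
move=> lf lg x y; have := lf x y; have := lg x y.
by rewrite /Num.max; case: ifPn; case: ifPn; rewrite -?leNgt; lra.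
Qed.

Lemma lip1_min f g : lip1 f -> lip1 g -> lip1 (fun x => Num.min (f x) (g x)).
Proof.
move=> lf lg x y; have := lf x y; have := lg x y.
by rewrite /Num.min; case: ifPn; case: ifPn; rewrite -?leNgt; lra.
Qed.

(** The extension is the infimum of the cones [w i + mdist x (t i)]. The family [t] may repeat
    points; the hypothesis then forces equal values. *)
Lemma mcshane (I : Type) (i0 : I) (t : I -> M) (w : I -> R) :
  (forall i j, w i - w j <= mdist (t i) (t j)) ->
  exists2 f, lip1 f & forall i, f (t i) = w i.
Proof.
move=> wt; pose A x := [set r | exists i, r = w i + mdist x (t i)].
have Ane x : A x !=set0 by exists (w i0 + mdist x (t i0)), i0.
have Ale x i : inf (A x) <= w i + mdist x (t i).
  apply: (@le_inf_elt _ _ (w i0 - mdist (t i0) x)); last by exists i.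
  move=> _ [j ->]; have := wt i0 j; have := metric_triangle (t i0) x (t j); lra.
exists (fun x => inf (A x)) => [x y|i].
  rewrite lerBlDr -lerBlDl; apply: lb_le_inf => // _ [i ->].
  have := Ale x i; have := metric_triangle x y (t i); lra.
apply/eqP; rewrite eq_le; apply/andP; split.
  by have := Ale (t i) i; rewrite mdistxx addr0.
by apply: lb_le_inf => // _ [j ->]; have := wt i j; lra.
Qed.

End Lipschitz1.

(** * The pairing of the free space with Lipschitz functions *)

Section ClosedSpanOps.
Variables (R : realType) (V : completeNormedModType R) (A : set V).
Implicit Types u v : closed_span A.

Lemma closed_span_valD u v : val (u + v) = val u + val v. Proof. by []. Qed.
Lemma closed_span_valZ a v : val (a *: v) = a *: val v. Proof. by []. Qed.
Lemma closed_span_valN v : val (- v) = - val v. Proof. by []. Qed.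
Lemma closed_span_normE v : `|v| = `|val v|. Proof. by []. Qed.

End ClosedSpanOps.

Section DualOps.
Variables (R : realType) (V : normedModType R).
Implicit Types phi psi : dual V.

Lemma dual_addE phi psi x : (phi + psi : dual V) x = phi x + psi x. Proof. by []. Qed.
Lemma dual_scaleE a phi x : (a *: phi : dual V) x = a * phi x. Proof. by []. Qed.
Lemma dual_oppE phi x : (- phi : dual V) x = - phi x. Proof. by []. Qed.

End DualOps.

Section Pairing.
Variables (R : realType) (M : metricType R) (x0 : M).
Local Notation F := (free_space x0).
Implicit Types (f g : M -> R) (u v : F).

Definition lipschitz_with (L : R) f := forall x y, f x - f y <= L * mdist x y.
Definition is_lipschitz f := exists L, lipschitz_with L f.

Lemma lip1P f : lip1 f <-> lipschitz_with 1 f.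
Proof. by split=> lf x y; have := lf x y; rewrite mul1r. Qed.

Lemma lip1_lipschitz f : lip1 f -> is_lipschitz f.
Proof. by move=> /lip1P lf; exists 1. Qed.

Lemma lipschitz_with_norm L f x y :
  lipschitz_with L f -> `|f x - f y| <= L * mdist x y.
Proof.
by move=> lf; rewrite ler_norml lf andbT; have := lf y x; rewrite metric_sym; lra.
Qed.

Lemma is_lipschitz_lin a f g : is_lipschitz f -> is_lipschitz g ->
  is_lipschitz (fun x => a * f x + g x).
Proof.
move=> [L Lf] [K Kg]; exists (`|a| * L + K) => x y.
have -> : a * f x + g x - (a * f y + g y) = a * (f x - f y) + (g x - g y) by ring.
rewrite mulrDl lerD// (le_trans (ler_norm _))// normrM -mulrA ler_wpM2l//.
exact: lipschitz_with_norm.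
Qed.

(* The class of [f - f x0] in [Lip_0(M)], with junk value 0 when [f] is not Lipschitz. *)
Definition to_lip0 f : lip0 x0 :=
  insubd 0 (fun x => f x - f x0 : R^o).

Lemma to_lip0E f x : is_lipschitz f -> to_lip0 f x = f x - f x0.
Proof.
move=> [L Lf]; rewrite /to_lip0 /lip0_fun insubdK// inE; split; first exact: subrr.
by exists L => p q; rewrite opprB addrA subrK; exact: lipschitz_with_norm.
Qed.

Definition free_val (v : F) : dual (lip0 x0) :=
  val (v : closed_span (range (@delta R M x0))).

Lemma free_valD u v : free_val (u + v) = free_val u + free_val v.
Proof. exact: closed_span_valD. Qed.

Lemma free_valZ a v : free_val (a *: v) = a *: free_val v.
Proof. exact: closed_span_valZ. Qed.

Lemma free_valN v : free_val (- v) = - free_val v.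
Proof. exact: closed_span_valN. Qed.

Lemma free_normE v : `|v| = dual_norm (free_val v).
Proof. exact: closed_span_normE. Qed.

(** The duality pairing, extended to Lipschitz functions that need not vanish at [x0]. Constants
    pair to 0, so no later estimate has to normalise its functions. *)
Definition ev (v : F) f : R := free_val v (to_lip0 f).

Lemma evD u v f : ev (u + v) f = ev u f + ev v f.
Proof. by rewrite /ev free_valD dual_addE. Qed.

Lemma evZ a v f : ev (a *: v) f = a * ev v f.
Proof. by rewrite /ev free_valZ dual_scaleE. Qed.

Lemma evN v f : ev (- v) f = - ev v f.
Proof. by rewrite /ev free_valN dual_oppE. Qed.

Lemma evB u v f : ev (u - v) f = ev u f - ev v f.
Proof. by rewrite evD evN. Qed.

Lemma ev_lin v a f g : is_lipschitz f -> is_lipschitz g ->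
  ev v (fun x => a * f x + g x) = a * ev v f + ev v g.
Proof.
move=> lf lg; rewrite /ev -dual_linear; congr (dual_fun _ _).
apply/val_inj/funext => x.
rewrite -[LHS]/(to_lip0 _ x) to_lip0E; last exact: is_lipschitz_lin.
rewrite -[RHS]/(a * to_lip0 f x + to_lip0 g x) !to_lip0E//; ring.
Qed.

Lemma ev_le v f L : 0 <= L -> lipschitz_with L f -> `|ev v f| <= `|v| * L.
Proof.
move=> L0 Lf; rewrite /ev free_normE (le_trans (dual_normP _ _))//.
rewrite ler_wpM2l ?dual_norm_ge0//.
suff: lip_norm (to_lip0 f) <= L by [].
apply: lip_norm_le => // p q; rewrite !to_lip0E; [|by exists L..].
by rewrite opprB addrA subrK; exact: lipschitz_with_norm.
Qed.

Lemma ev_cst v c : ev v (fun=> c) = 0.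
Proof.
apply/eqP; rewrite -normr_le0 -(mulr0 `|v|); apply: ev_le => // x y.
by rewrite mul0r subrr.
Qed.

Lemma ev_le1 v f : lip1 f -> `|ev v f| <= `|v|.
Proof. by move=> /lip1P lf; have := ev_le v ler01 lf; rewrite mulr1. Qed.

Lemma lip0_lip1 (f : lip0 x0) : lip_norm f <= 1 -> lip1 f.
Proof.
move=> f1 x y; rewrite (le_trans (ler_norm _))// (le_trans (lip_normP f x y))//.
by rewrite ler_piMl ?mdist_ge0.
Qed.

Lemma to_lip0K (f : lip0 x0) : to_lip0 f = f.
Proof.
apply/val_inj/funext => x; rewrite -[LHS]/(to_lip0 f x) to_lip0E ?lip0_at0 ?subr0//.
by exists (lip_norm f) => p q; rewrite (le_trans (ler_norm _))// lip_normP.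
Qed.

Lemma lip1N f : lip1 f -> lip1 (fun x => -1 * f x + 0).
Proof. by move=> lf x y; have := lf y x; rewrite metric_sym; lra. Qed.

Lemma evNr v f : lip1 f -> ev v (fun x => -1 * f x + 0) = - ev v f.
Proof.
move=> lf; rewrite (ev_lin v (-1) (lip1_lipschitz lf)) ?ev_cst ?mulN1r ?addr0//.
by exists 0 => x y; rewrite mul0r subrr.
Qed.

(** One-sided bounds suffice because [- f] is 1-Lipschitz along with [f]. *)
Lemma norm_le v c : 0 <= c -> (forall f, lip1 f -> ev v f <= c) -> `|v| <= c.
Proof.
move=> c0 vc; rewrite free_normE; apply: dual_norm_le => // f f1.
have lf := lip0_lip1 f1.
have <- : ev v (lip0_fun f) = free_val v f by rewrite /ev to_lip0K.
rewrite ler_norml vc// andbT.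
by have := vc _ (lip1N lf); rewrite evNr//; lra.
Qed.

Lemma norm_ev v e : 0 < e -> exists2 f, lip1 f & `|v| - e <= ev v f.
Proof.
move=> e0; have [ve|ve] := leP (`|v| - e) 0.
  by exists (fun=> 0); [move=> x y; rewrite subr0 mdist_ge0|rewrite ev_cst].
apply: contrapT => nf.
suff : `|v| <= `|v| - e by lra.
apply: norm_le => [|f lf]; first exact: ltW.
by rewrite leNgt; apply/negP => vf; apply: nf; exists f => //; exact: ltW.
Qed.

End Pairing.

(** * Finite combinations of molecules and Kantorovich duality *)

Lemma addrBD (V : zmodType) (u v x y : V) : u + v - (x + y) = (u - x) + (v - y).
Proof. by rewrite opprD addrACA. Qed.

Section Molecules.
Variables (R : realType) (M : metricType R) (x0 : M).
Local Notation F := (free_space x0).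
Implicit Types (f g : M -> R) (v : F) (xs ys : seq (R * M * M)).

Lemma free_delta_subproof p :
  delta x0 p \in closed_span_pred (range (@delta R M x0)).
Proof.
rewrite inE; apply: subset_closure; exists 1, (fun=> 1), (fun=> delta x0 p).
by split=> [_|]; [exists p|rewrite big_ord1 scale1r].
Qed.

Definition free_delta p : F := exist _ (delta x0 p) (free_delta_subproof p).

Lemma ev_delta p f : is_lipschitz f -> ev (free_delta p) f = f p - f x0.
Proof. by move=> lf; rewrite -to_lip0E. Qed.

Lemma free_val_delta p : free_val (free_delta p) = delta x0 p.
Proof. by []. Qed.

(* A triple [(c, p, q)] stands for [c (delta_p - delta_q)]. *)
Definition comb xs : F :=
  \sum_(z <- xs) z.1.1 *: (free_delta z.1.2 - free_delta z.2).

Definition eval f xs : R := \sum_(z <- xs) z.1.1 * (f z.1.2 - f z.2).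

Definition weight xs : R := \sum_(z <- xs) `|z.1.1| * mdist z.1.2 z.2.

Definition scale a xs : seq (R * M * M) :=
  [seq (a * z.1.1, z.1.2, z.2) | z <- xs].

Lemma weight_ge0 xs : 0 <= weight xs.
Proof. by apply: sumr_ge0 => z _; rewrite mulr_ge0 ?mdist_ge0. Qed.

Lemma comb_cat xs ys : comb (xs ++ ys) = comb xs + comb ys.
Proof. exact: big_cat. Qed.

Lemma weight_cat xs ys : weight (xs ++ ys) = weight xs + weight ys.
Proof. exact: big_cat. Qed.

Lemma eval_cat f xs ys : eval f (xs ++ ys) = eval f xs + eval f ys.
Proof. exact: big_cat. Qed.

Lemma comb_scale a xs : comb (scale a xs) = a *: comb xs.
Proof.
rewrite /comb big_map scaler_sumr; apply: eq_bigr => z _ /=.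
by rewrite scalerA.
Qed.

Lemma weight_scale a xs : weight (scale a xs) = `|a| * weight xs.
Proof.
rewrite /weight big_map mulr_sumr; apply: eq_bigr => z _ /=.
by rewrite normrM mulrA.
Qed.

Lemma ev_comb xs f : is_lipschitz f -> ev (comb xs) f = eval f xs.
Proof.
move=> lf; rewrite /comb /eval; elim: xs => [|z xs IH].
  rewrite !big_nil; have := evZ 0 (0 : F) f.
  by rewrite scaler0 mul0r.
by rewrite !big_cons evD evZ evB !ev_delta// IH; ring.
Qed.

Lemma eval_le f xs : lip1 f -> `|eval f xs| <= weight xs.
Proof.
move=> lf; rewrite /eval /weight (le_trans (ler_norm_sum _ _ _))//.
by apply: ler_sum => z _; rewrite normrM ler_wpM2l// lip1_norm.
Qed.

Lemma free_delta0 : free_delta x0 = 0.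
Proof.
by apply/val_inj/val_inj/funext => f; exact: (lip0_at0 f).
Qed.

Lemma comb_dense v e : 0 < e -> exists xs, `|v - comb xs| < e.
Proof.
move=> e0; have /set_mem/closure_normP/(_ e e0)[w] := valP (v : closed_span _).
move=> [n [c [a [ac ->]]]] vw.
have /choice[p pa] : forall i, exists p, delta x0 p = a i.
  by move=> i; have [p _ pa] := ac i; exists p.
(* The functional [delta x0 x0] vanishes, so each [delta x0 p] is a molecule based at [x0]. *)
exists [seq (c i, p i, x0) | i <- index_enum 'I_n].
have E : free_val (comb [seq (c i, p i, x0) | i <- index_enum 'I_n]) =
    \sum_(i < n) c i *: a i.
  rewrite /comb big_map; elim: (index_enum _) => [|i s IH].
    by rewrite !big_nil -(scale0r (0 : F)) free_valZ scale0r.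
  rewrite !big_cons free_valD IH free_valZ free_valD free_valN free_delta0.
  rewrite free_val_delta pa -(scale0r (0 : F)) free_valZ scale0r.
  by rewrite subr0.
by rewrite free_normE free_valD free_valN E.
Qed.

(** The infimal convolution of the transport cost with [K] times the norm; the penalty admits
    elements that are not finite combinations. *)
Definition relaxed_weight (K : R) v : R :=
  inf [set r | exists xs, r = weight xs + K * `|v - comb xs|].

Lemma relaxed_weight_le K v xs : 0 <= K ->
  relaxed_weight K v <= weight xs + K * `|v - comb xs|.
Proof.
move=> K0; apply: (@le_inf_elt _ _ 0); last by exists xs.
by move=> _ [ys ->]; rewrite addr_ge0 ?weight_ge0// mulr_ge0.
Qed.

Lemma relaxed_weight_sublinear K : 0 <= K -> sublinear (relaxed_weight K).
Proof.
move=> K0; have ne v : [set r | exists xs, r = weight xs + K * `|v - comb xs|]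
    !=set0 by exists (weight [::] + K * `|v - comb [::]|), [::].
have comb0 : comb [::] = 0 by rewrite /comb big_nil.
have weight0 : weight [::] = 0 by rewrite /weight big_nil.
split=> [u v|a v].
  rewrite -lerBlDr; apply: lb_le_inf => // _ [xs ->].
  rewrite lerBlDr -lerBlDl; apply: lb_le_inf => // _ [ys ->]; rewrite lerBlDl.
  apply: le_trans (relaxed_weight_le (u + v) (xs ++ ys) K0) _.
  have -> : u + v - comb (xs ++ ys) = (u - comb xs) + (v - comb ys).
    by rewrite comb_cat; exact: addrBD.
  by rewrite weight_cat [leRHS]addrACA lerD2l -mulrDr ler_wpM2l// ler_normD.
rewrite [0 <= a]le_eqVlt => /predU1P[<-|a0].
  rewrite scale0r mul0r (le_trans (relaxed_weight_le 0 [::] K0))//.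
  by rewrite comb0 weight0 subrr normr0 mulr0 addr0.
rewrite -ler_pdivrMl//; apply: lb_le_inf => // _ [xs ->].
rewrite ler_pdivrMl// (le_trans (relaxed_weight_le _ (scale a xs) K0))//.
by rewrite comb_scale weight_scale -scalerBr normrZ gtr0_norm// mulrDr mulrCA.
Qed.

(* Kantorovich duality: the norm is an infimum of weights, up to a small error
   that is controlled by taking [K] large. *)
Lemma near_optimal_comb K v e : 0 <= K -> 0 < e ->
  exists xs, weight xs + K * `|v - comb xs| <= `|v| + e.
Proof.
move=> K0 e0.
have comb0 : comb [::] = 0 by rewrite /comb big_nil.
have weight0 : weight [::] = 0 by rewrite /weight big_nil.
have [l [lD lZ lp lv]] := hahn_banach v (relaxed_weight_sublinear K0).
have lN w : l (- w) = - l w by rewrite -scaleN1r lZ mulN1r.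
(* On point masses the supporting functional [l] is a Kantorovich potential: it is 1-Lipschitz
   because a single molecule costs at most the distance of its points. *)
pose h x := l (free_delta x).
have h1 : lip1 h.
  move=> x y; rewrite /h -lN -lD (le_trans (lp _))//.
  rewrite (le_trans (relaxed_weight_le _ [:: (1, x, y)] K0))//.
  rewrite /weight /comb !big_seq1/= scale1r subrr normr0 mulr0 addr0.
  by rewrite normr1 mul1r.
have lcomb xs : l (comb xs) = ev (comb xs) h.
  rewrite ev_comb; last exact: lip1_lipschitz.
  rewrite /comb /eval; elim: xs => [|z xs IH].
    by rewrite !big_nil -(scale0r (0 : F)) lZ mul0r.
  by rewrite !big_cons lD IH lZ lD lN.
(* [l] and the pairing with [h] agree on combinations, and on the remainder [l] exceeds the pairing
   by at most [K + 1] times the norm; density finishes. *)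
have lev : l v <= ev v h.
  apply/ler_addgt0Pr => d d0.
  have K1 : 0 < K + 1 by rewrite ltr_wpDl.
  have [xs] := comb_dense v (divr_gt0 d0 K1).
  rewrite ltr_pdivlMr// mulrC => vxs.
  have E : l v = l (comb xs) + l (v - comb xs) by rewrite -lD addrC subrK.
  have h2 := lp (v - comb xs).
  have h3 := relaxed_weight_le (v - comb xs) [::] K0.
  rewrite weight0 comb0 subr0 add0r in h3.
  have := ev_le1 (v - comb xs) h1; rewrite evB ler_norml => /andP[h4 _].
  move: vxs h2 h3 h4; rewrite E lcomb.
  move: (`|v - comb xs|) (l (v - comb xs)) (relaxed_weight K _) => n a b; lra.
have pv : relaxed_weight K v <= `|v|.
  by rewrite -lv (le_trans lev)// (le_trans (ler_norm _))// ev_le1.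
have [|_ [xs ->] xsl] := @inf_adherent _
    [set r | exists xs, r = weight xs + K * `|v - comb xs|] _ e0.
  split; first by exists (weight [::] + K * `|v - comb [::]|), [::].
  by exists 0 => _ [xs ->]; rewrite addr_ge0 ?weight_ge0// mulr_ge0.
exists xs; rewrite (le_trans (ltW xsl))// lerD2r; exact: pv.
Qed.

End Molecules.

(** * Sampling points on nearly shortest paths *)

Section LengthPoints.
Variables (R : realType) (M : metricType R).

Lemma lip1_continuous (f : M -> R) : lip1 f -> continuous f.
Proof.
move=> lf x; apply/cvgrPdist_lt => e e0; apply/nbhs_ballP; exists e => //= y.
by rewrite ballEmdist/= => xy; rewrite (le_lt_trans (lip1_norm _ _ lf)).
Qed.

Lemma mdist_lip1 (p : M) : lip1 (mdist p).
Proof. by move=> x y; have := metric_triangle p y x; rewrite (metric_sym y); lra. Qed.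

Lemma path_length_ge (a b : R) (g : R -> M) n (t : nat -> R) :
  t 0 = a -> t n = b -> (forall i, (i < n)%N -> t i <= t i.+1) ->
  ((\sum_(i < n) mdist (g (t i)) (g (t i.+1)))%:E <= path_length a b g)%E.
Proof. by move=> t0 tn tm; apply: ereal_sup_ubound; exists n, t. Qed.

(** The points lie at equally spaced levels of [mdist p] on a path of length less than
    [mdist p q + theta]. Reaching the last level already uses length [mdist p q], so less than
    [theta] is left before [q]. *)
Lemma length_space_points (p q : M) (theta : R) : length_space M -> 0 < theta ->
  exists n (d : R) (t : nat -> M),
    [/\ 0 <= d <= theta, n%:R * d = mdist p q,
        (forall k, (k <= n)%N -> mdist p (t k) = k%:R * d) /\ t 0 = p,
        \sum_(k < n) mdist (t k) (t k.+1) <= mdist p q + theta &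
        mdist (t n) q <= theta].
Proof.
move=> lenM th0; have [<-|/eqP pq] := eqVneq p q.
  exists 0, 0, (fun=> p); rewrite mul0r mdistxx big_ord0; split=> //.
  - by rewrite lexx ltW.
  - by split=> // k _; rewrite ?mdistxx mulr0.
  - by rewrite add0r ltW.
  - exact: ltW.
set D := mdist p q.
have [_ [a [b [g [[ab gc ga gb] _ _ ->]]]] gl] : exists2 l,
    [set l | exists (a b : R) (g : R -> M), [/\ path_between p q a b g,
      simple_path a b g, (path_length a b g < +oo)%E & l = path_length a b g]] l
    & (l < (D + theta)%:E)%E.
  by apply: ereal_inf_lt; rewrite -lenM// lte_fin ltrDl.
have D0 : 0 <= D := mdist_ge0 _ _.
pose u s := mdist p (g s).
have uc : {within `[a, b], continuous u}.
  by apply: within_continuous_comp gc => x _; exact: (lip1_continuous (mdist_lip1 p)).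
pose n := (Num.truncn (D / theta)).+1.
have nD : D < n%:R * theta by rewrite -ltr_pdivrMr// truncnS_gt.
have n0 : 0 < n%:R :> R by rewrite ltr0n.
pose d := D / n%:R.
(* The intermediate value theorem on the rest of the path finds the next level, so that the chosen
   parameters increase. *)
have /choice[nxt nxtP] : forall sc : R * R, exists s', a <= sc.1 <= b ->
    u sc.1 <= sc.2 <= D -> [/\ sc.1 <= s', s' <= b & u s' = sc.2].
  move=> [s c] /=; have [/andP[as_ sb]|h] := boolP (a <= s <= b); last by exists s.
  have [/andP[uc1 cD]|h] := boolP (u s <= c <= D); last by exists s.
  have [||s'] := @IVT R u s b c sb.
  - apply: continuous_subspaceW uc => x /=; rewrite !in_itv/= => /andP[sx ->].
    by rewrite (le_trans as_ sx).
  - by rewrite /u gb -/D /Num.min /Num.max ltNge -/(u s); case: ifPn; rewrite ?negbK; lra.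
  - by rewrite in_itv/= => /andP[ss' s'b] us'; exists s'.
pose fix tau k := if k is k'.+1 then nxt (tau k', k%:R * d) else a.
have kd k : (k <= n)%N -> k%:R * d <= D.
  by move=> kn; rewrite /d mulrA ler_pdivrMr// mulrC ler_wpM2l// ler_nat.
have d0 : 0 <= d by rewrite divr_ge0// ltW.
have tauP k : (k <= n)%N -> [/\ a <= tau k, tau k <= b & u (tau k) = k%:R * d].
  elim: k => [_|k IH kn]; first by rewrite /= /u ga mdistxx mul0r.
  have [ak kb uk] := IH (ltnW kn).
  have [] := nxtP (tau k, k.+1%:R * d); rewrite /= ?ak ?kb ?uk ?kd//.
    by rewrite andbT ler_wpM2r// ler_nat.
  by move=> h1 h2 h3; split=> //; exact: le_trans ak h1.
have tauS k : (k < n)%N -> tau k <= tau k.+1.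
  move=> kn; have [ak kb uk] := tauP k (ltnW kn).
  have [] := nxtP (tau k, k.+1%:R * d); rewrite /= ?ak ?kb ?uk ?kd//.
  by rewrite andbT ler_wpM2r// ler_nat.
(* The end [b] becomes one more partition point, so that the length bound also controls the piece
   from [tau n] to [q]. *)
pose t' i := if (i <= n)%N then tau i else b.
have : ((\sum_(i < n.+1) mdist (g (t' i)) (g (t' i.+1)))%:E <= path_length a b g)%E.
  apply: path_length_ge => [//||i]; first by rewrite /t' ltnn.
  rewrite ltnS /t' => ii; rewrite ii; case: ifPn => [|_]; first exact: tauS.
  by have [] := tauP i ii.
have t'n : t' n = tau n by rewrite /t' leqnn.
have t'b : t' n.+1 = b by rewrite /t' ltnn.
move=> /le_lt_trans/(_ gl); rewrite lte_fin big_ord_recr/= t'n t'b gb => lsum.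
have lsum' : \sum_(k < n) mdist (g (tau k)) (g (tau k.+1)) + mdist (g (tau n)) q < D + theta.
  apply: le_lt_trans lsum; rewrite lerD2r le_eqVlt; apply/orP; left; apply/eqP.
  by apply: eq_bigr => i _; rewrite /t' (ltnW (ltn_ord i)) ltn_ord.
have tri k : (k <= n)%N ->
    mdist p (g (tau k)) <= \sum_(i < k) mdist (g (tau i)) (g (tau i.+1)).
  elim: k => [_|k IH kn]; first by rewrite big_ord0 /= ga mdistxx.
  rewrite big_ord_recr/= (le_trans (metric_triangle _ (g (tau k)) _))//.
  by rewrite lerD2r IH// ltnW.
have [_ _ un] := tauP n (leqnn _); have := tri n (leqnn _).
rewrite -/(u (tau n)) un => tn.
have nd : n%:R * d = D by rewrite /d mulrC divfK// gt_eqF.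
exists n, d, (g \o tau); split=> //.
- rewrite d0/= /d ler_pdivrMr// mulrC; exact: ltW.
- by split=> // k kn; have [] := tauP k kn.
- by have := mdist_ge0 (g (tau n)) q; move: lsum'; rewrite /=; lra.
- by move: lsum' tn; rewrite nd /=; lra.
Qed.

End LengthPoints.

(** * Oscillating functions along sampled paths *)

Section Oscillation.
Variables (R : realType) (M : metricType R).
Implicit Types (f g : M -> R) (xs ys : seq (R * M * M)).

Lemma lip1_shift f c : lip1 f -> lip1 (fun x => f x + c).
Proof. by move=> lf x y; have := lf x y; lra. Qed.

Lemma eval_scale g a xs : eval g (scale a xs) = a * eval g xs.
Proof.
rewrite /eval big_map mulr_sumr; apply: eq_bigr => z _ /=; exact: esym (mulrA _ _ _).
Qed.

(* The signs make the function [w] along the points follow [f'], so they nearly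
   cancel; hence for every [g] the signed and the unsigned increments compete. *)
Lemma oscillating_block (p q : M) theta eta f' : length_space M -> 0 < theta ->
  lip1 f' -> (forall x, `|f' x| <= eta) ->
  exists bs f, [/\ lip1 f, forall x, `|f x - f' x| <= 3 * theta,
    eval f bs = mdist p q &
    forall g, lip1 g ->
      `|g p - g q| + `|eval g bs| <= mdist p q + 6 * theta + 2 * eta].
Proof.
move=> lenM th0 lf' f'eta.
have [n [d [t [/andP[d0 dth] nd [tk t0] tlen tq]]]] := length_space_points p q lenM th0.
set D := mdist p q in nd tlen *.
(* Starting at [f' p], [w] moves by [d] at each step, up when it is not above [f'] and down
   otherwise. *)
pose fix w k := if k is k'.+1 then
  w k' + (if w k' <= f' (t k') then 1 else -1) * d else f' p.
pose s k : R := if w k <= f' (t k) then 1 else -1.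
pose D_ k := mdist (t k) (t k.+1).
have wS k : w k.+1 = w k + s k * d by [].
have s1 k : s k = 1 \/ s k = -1 by rewrite /s; case: ifP; [left|right].
have dD k : (k < n)%N -> d <= D_ k.
  move=> kn; have := metric_triangle p (t k) (t k.+1).
  by rewrite (tk _ kn) (tk _ (ltnW kn)) -/(D_ k) -[k.+1]addn1 natrD; lra.
(* Every step of the path has length at least [d]; the excesses add up to at most [theta]. *)
pose E k := \sum_(i < k) (D_ i - d).
have ES k : E k.+1 = E k + (D_ k - d) by rewrite /E big_ord_recr.
have E_mono k m : (k + m <= n)%N -> E k <= E (k + m)%N.
  elim: m => [|m IH]; first by rewrite addn0.
  rewrite addnS => kmn; rewrite ES (le_trans (IH (ltnW kmn)))//.
  by rewrite lerDl subr_ge0 dD.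
have En : E n <= theta.
  by rewrite /E big_split/= sumr_const card_ord -[- d *+ n]mulr_natl mulrN nd; lra.
have Eth k : (k <= n)%N -> E k <= theta.
  by move=> kn; rewrite (le_trans _ En)//; have := @E_mono k (n - k)%N; rewrite subnKC//; exact.
have E0 k : (k <= n)%N -> 0 <= E k.
  by move=> kn; have := @E_mono 0%N k; rewrite add0n {1}/E big_ord0; exact.
have track k : (k <= n)%N -> `|w k - f' (t k)| <= 2 * d + E k.
  elim: k => [_|k IH kn].
    by rewrite /= t0 subrr normr0 /E big_ord0; lra.
  have := IH (ltnW kn); have := E0 k (ltnW kn).
  have := lf' (t k) (t k.+1); have := lf' (t k.+1) (t k).
  rewrite [mdist (t k.+1) _]metric_sym -/(D_ k); have := dD k kn.
  rewrite ES wS /s !ler_norml; case: ifPn; rewrite -?ltNge; lra.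
have track3 k : (k <= n)%N -> `|w k - f' (t k)| <= 3 * theta.
  by move=> kn; have := track k kn; have := Eth k kn; lra.
have wstep i m : `|w (i + m)%N - w i| <= m%:R * d.
  elim: m => [|m IH]; first by rewrite addn0 subrr normr0 mul0r.
  rewrite addnS wS -[m.+1]addn1 natrD mulrDl mul1r.
  move: IH; rewrite !ler_norml; case: (s1 (i + m)%N) => ->; lra.
have wlip i j : (i <= j)%N -> (j <= n)%N -> `|w j - w i| <= mdist (t i) (t j).
  move=> ij jn; have := wstep i (j - i)%N; rewrite subnKC// natrB// mulrBl.
  rewrite -(tk _ jn) -(tk _ (leq_trans ij jn)) => h; apply: le_trans h _.
  by have := metric_triangle p (t i) (t j); lra.
(* Indices are capped at [n], since the Lipschitz estimate [wlip] holds only up to there. *)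
have [|h lh hw] := @mcshane R M nat 0%N (fun i => t (minn i n)) (fun i => w (minn i n)).
  move=> i j /=; rewrite (le_trans (ler_norm _))//.
  have [ij|/ltnW ij] := leqP (minn i n) (minn j n).
    by rewrite distrC wlip// geq_minr.
  by rewrite metric_sym wlip// geq_minr.
(* Truncating the extension to the band of radius [3 * theta] around [f'] keeps it 1-Lipschitz and,
   by [track3], unchanged at the points [t k]. *)
pose f x := Num.max (f' x + - (3 * theta)) (Num.min (h x) (f' x + 3 * theta)).
have lf : lip1 f.
  by apply: lip1_max; [exact: lip1_shift|apply: lip1_min => //; exact: lip1_shift].
have ff' x : `|f x - f' x| <= 3 * theta.
  rewrite ler_norml /f /Num.max /Num.min; do 2 case: ifPn; rewrite -?leNgt; lra.
have fw k : (k <= n)%N -> f (t k) = w k.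
  move=> kn; have := hw k; rewrite /= (minn_idPl kn) /f => ->.
  have := track3 k kn; rewrite ler_norml /Num.max /Num.min.
  by do 2 case: ifPn; rewrite -?leNgt; lra.
pose bs := [seq (s k, t k.+1, t k) | k <- index_iota 0 n].
have evalE g : eval g bs = \sum_(k < n) s k * (g (t k.+1) - g (t k)).
  by rewrite /eval big_map big_mkord.
exists bs, f; split=> //.
  rewrite evalE (eq_bigr (fun=> d)) => [|k _].
    by rewrite sumr_const card_ord -mulr_natl.
  rewrite (fw _ (ltn_ord k)) (fw _ (ltnW (ltn_ord k))) wS.
  case: (s1 k) => ->; ring.
move=> g lg; rewrite evalE.
set b := \sum_(k < n) s k * _.
have aE : g (t n) - g p = \sum_(k < n) (g (t k.+1) - g (t k)).
  by rewrite -(big_mkord xpredT (fun k => g (t k.+1) - g (t k))) telescope_sumr// t0.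
(* The signed steps sum to the net displacement of [w], which is small because [w] follows [f'] and
   [f'] is bounded by [eta]. *)
have swE : \sum_(k < n) s k * d = w n - f' p.
  rewrite (eq_bigr (fun k : 'I_n => w k.+1 - w k)) => [|k _]; last by rewrite wS addrC addKr.
  by rewrite -(big_mkord xpredT (fun k => w k.+1 - w k)) telescope_sumr.
have sDE : \sum_(k < n) s k * D_ k = w n - f' p + \sum_(k < n) s k * (D_ k - d).
  by rewrite -swE -big_split/=; apply: eq_bigr => k _; ring.
have sEn : `|\sum_(k < n) s k * (D_ k - d)| <= theta.
  rewrite (le_trans _ En)// (le_trans (ler_norm_sum _ _ _))//.
  apply: ler_sum => k _; rewrite normrM.
  have -> : `|s k| = 1 by case: (s1 k) => ->; rewrite ?normrN normr1.
  by rewrite mul1r ger0_norm// subr_ge0 dD.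
have wn : `|w n - f' p| <= 3 * theta + 2 * eta.
  have := track3 n (leqnn n); have := f'eta (t n); have := f'eta p.
  rewrite !ler_norml; lra.
set a := g (t n) - g p in aE *.
have Dl k : g (t k.+1) - g (t k) <= D_ k by have := lg (t k.+1) (t k); rewrite metric_sym.
have Dr k : - (g (t k.+1) - g (t k)) <= D_ k by have := lg (t k) (t k.+1); rewrite -/(D_ k); lra.
(* For signs [x] and [y], [|x + y * s k| = 1 + x * y * s k]; so the increment of [g] over step [k]
   contributes at most [D_ k + x * y * s k * D_ k]. *)
have ab : forall x y : R, (x = 1 \/ x = -1) -> (y = 1 \/ y = -1) ->
    x * a + y * b <= \sum_(k < n) D_ k + `|\sum_(k < n) s k * D_ k|.
  move=> x y x1 y1.
  have xy1 : `|x * y| = 1 by case: x1 => ->; case: y1 => ->; rewrite normrM ?normrN !normr1 mulr1.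
  rewrite -[`|\sum_(k < n) s k * D_ k|]mul1r -xy1 -normrM.
  apply: le_trans (lerD (lexx _) (ler_norm _)).
  rewrite aE /b !mulr_sumr -!big_split/=; apply: ler_sum => k _.
  have := Dl k; have := Dr k.
  by case: x1 => ->; case: y1 => ->; case: (s1 k) => ->; lra.
have sab : `|a| + `|b| <= \sum_(k < n) D_ k + `|\sum_(k < n) s k * D_ k|.
  have I1 : (1:R) = 1 \/ (1:R) = -1 by left.
  have I2 : (-1:R) = 1 \/ (-1:R) = -1 by right.
  have := ab _ _ I1 I1; have := ab _ _ I1 I2; have := ab _ _ I2 I1; have := ab _ _ I2 I2.
  by case: (ger0P a); case: (ger0P b); lra.
have := lip1_norm (t n) q lg => gq.
have pq : `|g p - g q| <= `|a| + theta.
  have -> : g p - g q = - a + (g (t n) - g q) by rewrite /a; ring.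
  rewrite (le_trans (ler_normD _ _))// normrN lerD2l; exact: le_trans gq tq.
have : `|\sum_(k < n) s k * D_ k| <= 3 * theta + 2 * eta + theta.
  by rewrite sDE (le_trans (ler_normD _ _))// lerD.
move: sab pq tlen; rewrite -/(\sum_(k < n) D_ k); lra.
Qed.

Lemma eval_close f f' ys c : 0 <= c -> (forall x, `|f x - f' x| <= c) ->
  eval f' ys <= eval f ys + 2 * c * \sum_(z <- ys) `|z.1.1|.
Proof.
move=> c0 ff'; rewrite mulr_sumr /eval -big_split/=; apply: ler_sum => z _.
rewrite -lerBlDl -mulrBr (le_trans (ler_norm _))// normrM mulrC ler_wpM2r//.
have := ff' z.1.2; have := ff' z.2; rewrite !ler_norml; lra.
Qed.

(** Induction on the molecules: the block for a new molecule oscillates around the function built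
    for the others, so that a single [f] nearly norms all blocks. The block is scaled by [|c|]
    because only absolute values enter. *)
Lemma near_orthogonal_comb xs e : length_space M -> 0 < e ->
  exists ys f, [/\ lip1 f, forall x, `|f x| <= e, weight xs - e <= eval f ys &
    forall g, lip1 g -> `|eval g xs| + `|eval g ys| <= weight xs + e].
Proof.
move=> lenM; elim: xs e => [|[[c p] q] xs IH] e e0.
  exists [::], (fun=> 0); rewrite /weight /eval !big_nil; split=> [x y|x||g lg].
  - by rewrite subrr mdist_ge0.
  - by rewrite normr0 ltW.
  - by rewrite sub0r oppr_le0 ltW.
  - by rewrite /eval !big_nil normr0 !add0r ltW.
have c1 : 0 < 4 * (`|c| + 1) by rewrite mulr_gt0// ltr_wpDl.
pose e' := e / (4 * (`|c| + 1)).
have e'0 : 0 < e' by rewrite divr_gt0.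
have e'E : 4 * (`|c| * e') + 4 * e' = e by rewrite /e'; field; rewrite gt_eqF// ltr_wpDl.
have [ys [f' [lf' f'e f'ys gys]]] := IH _ e'0.
pose A := \sum_(z <- ys) `|z.1.1|.
have A0 : 0 <= A by apply: sumr_ge0.
have Ac1 : 0 < 24 * (A + `|c| + 1) by rewrite mulr_gt0// ltr_wpDl// addr_ge0.
(* This choice has to follow that of [ys]: passing from [f'] to [f] costs [6 * theta * A], and the
   new block costs [6 * |c| * theta]. *)
pose theta := e / (24 * (A + `|c| + 1)).
have th0 : 0 < theta by rewrite divr_gt0.
have thE : 24 * (A * theta) + 24 * (`|c| * theta) + 24 * theta = e.
  by rewrite /theta; field; rewrite gt_eqF// ltr_wpDl// addr_ge0.
have [bs [f [lf ff' fbs gbs]]] := oscillating_block p q lenM th0 lf' f'e.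
have ce' : 0 <= `|c| * e' by rewrite mulr_ge0// ltW.
have cth : 0 <= `|c| * theta by rewrite mulr_ge0// ltW.
have Ath : 0 <= A * theta by rewrite mulr_ge0// ltW.
exists (scale `|c| bs ++ ys), f; split=> // [x||g lg].
- by have := ff' x; have := f'e x; rewrite !ler_norml; lra.
- rewrite /weight big_cons -/(weight xs) eval_cat eval_scale fbs /=.
  have th3 : 0 <= 3 * theta by rewrite mulr_ge0// ltW.
  by have := eval_close ys th3 ff'; rewrite -/A; lra.
rewrite /weight /eval !big_cons -/(weight xs) -!/(eval _ _) eval_cat eval_scale /=.
have h1 := gys g lg; have h2 := ler_wpM2l (normr_ge0 c) (gbs g lg).
have h3 := ler_normD (c * (g p - g q)) (eval g xs).
have h4 := ler_normD (`|c| * eval g bs) (eval g ys).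
by move: h3 h4; rewrite !normrM normr_id; lra.
Qed.

End Oscillation.

(** * Length spaces have locally almost square free spaces *)

(** The errors add up to [7 * eta]: [2 * eta] for replacing [x] by [c], [2 * eta] from the bounds on
    [c + y] and [c - y], and [3 * eta] for normalising [y]. *)
Lemma normalize_almost_square (R : realType) (V : normedModType R) (x c y : V)
    (eta e : R) : 0 < eta -> 8 * eta <= e -> 8 * eta <= 1 -> `|x - c| <= 2 * eta ->
  1 - 3 * eta <= `|y| -> `|y| <= 1 + 2 * eta ->
  `|c + y| <= 1 + 2 * eta -> `|c - y| <= 1 + 2 * eta ->
  exists z : V, [/\ `|z| = 1, `|x + z| <= 1 + e & `|x - z| <= 1 + e].
Proof.
move=> eta0 e8 e1 xc y1 y2 cy1 cy2; have ny : 0 < `|y| by lra.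
exists (`|y|^-1 *: y).
have z1 : Num.norm (`|y|^-1 *: y) = 1 by rewrite normrZ normfV normr_id mulVf// gt_eqF.
have zy : Num.norm (y - `|y|^-1 *: y) <= 3 * eta.
  have -> : y - `|y|^-1 *: y = (`|y| - 1) *: (`|y|^-1 *: y).
    by rewrite scalerBl scale1r scalerA mulfV ?gt_eqF// scale1r.
  by rewrite normrZ z1 mulr1 ler_norml; lra.
split=> //.
  have -> : x + `|y|^-1 *: y = (x - c) + (c + y) - (y - `|y|^-1 *: y).
    by rewrite [x - c + _]addrA subrK opprB addrACA subrr addr0.
  rewrite (le_trans (ler_normB _ _))//; have := ler_normD (x - c) (c + y); lra.
have -> : x - `|y|^-1 *: y = (x - c) + (c - y) + (y - `|y|^-1 *: y).
  by rewrite [x - c + _]addrA subrK addrA subrK.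
rewrite (le_trans (ler_normD _ _))//; have := ler_normD (x - c) (c - y); lra.
Qed.

Lemma length_space_locally_almost_square (R : realType) (M : metricType R) (x0 : M) :
  length_space M -> locally_almost_square (free_space x0).
Proof.
move=> lenM e x e0 x1; pose eta := Num.min e 1 / 8.
have [eta0 eta1 eta8] : [/\ 0 < eta, 8 * eta <= e & 8 * eta <= 1].
  by rewrite /eta /Num.min; case: ifPn; rewrite -?leNgt; split; lra.
(* With penalty [eta^-1], a relaxed cost of at most [1 + eta] puts the combination within
   [eta * (1 + eta) <= 2 * eta] of [x]. *)
have K0 : 0 <= eta^-1 by rewrite invr_ge0 ltW.
have [xs] := near_optimal_comb x K0 eta0.
have [ys [f [lf _ fys gys]]] := near_orthogonal_comb xs lenM eta0.
rewrite x1 => hxs.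
have wxs : weight xs <= 1 + eta.
  by rewrite (le_trans _ hxs)// lerDl mulr_ge0.
have xc : `|x - comb x0 xs| <= 2 * eta.
  have : eta^-1 * `|x - comb x0 xs| <= 1 + eta.
    by rewrite (le_trans _ hxs)// lerDr weight_ge0.
  rewrite ler_pdivrMl// => h; apply: le_trans h _; clear -eta0 eta8; nra.
have cw : `|comb x0 xs| <= weight xs.
  apply: norm_le => [|g lg]; first exact: weight_ge0.
  rewrite ev_comb; last exact: lip1_lipschitz.
  by rewrite (le_trans (ler_norm _))// eval_le.
have w1 : 1 - 2 * eta <= weight xs.
  rewrite (le_trans _ cw)//; have := le_trans (lerB_dist x (comb x0 xs)) xc.
  rewrite x1; move: (Num.norm (comb x0 xs)) => n; clear; lra.
have bound (y : free_space x0) : (forall g, lip1 g -> ev y g <= weight xs + eta) ->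
    `|y| <= 1 + 2 * eta.
  move=> h; apply: (@le_trans _ _ (weight xs + eta)); last by clear -wxs; lra.
  by apply: norm_le => //; clear -w1 eta8; lra.
apply: (@normalize_almost_square _ _ x (comb x0 xs) (comb x0 ys) eta) => //.
- apply: (@le_trans _ _ (eval f ys)); first by clear -fys w1; lra.
  rewrite -(ev_comb x0); last exact: lip1_lipschitz.
  by rewrite (le_trans (ler_norm _))// ev_le1.
- apply: bound => g lg; rewrite ev_comb; last exact: lip1_lipschitz.
  have := gys g lg; have := ler_norm (eval g ys); have := normr_ge0 (eval g xs).
  clear; lra.
- apply: bound => g lg; rewrite evD !ev_comb; [|exact: lip1_lipschitz..].
  have := gys g lg; have := ler_norm (eval g ys); have := ler_norm (eval g xs).
  clear; lra.
- apply: bound => g lg; rewrite evB !ev_comb; [|exact: lip1_lipschitz..].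
  have := gys g lg; have := ler_norm (- eval g ys); have := ler_norm (eval g xs).
  rewrite normrN; clear; lra.
Qed.

(** * Almost optimal Lipschitz curves from approximate midpoints *)

Section DyadicCurve.
Variables (R : realType) (M : metricType R).

Let h n : R := 2^-1 ^+ n.

Lemma geometric_gt0 n : 0 < h n.
Proof. by rewrite exprn_gt0// invr_gt0. Qed.

Lemma geometricS n : h n.+1 = h n / 2.
Proof. by rewrite /h exprS mulrC. Qed.

Lemma geometricK n : 2 ^+ n * h n = 1.
Proof. by rewrite -exprMn divff ?expr1n. Qed.

Lemma geometric_small c e : 0 < e -> exists n, c * h n < e.
Proof.
move=> e0; pose n := Num.truncn (c / e); exists n.
have cn : c < n.+1%:R * e by rewrite -ltr_pdivrMr// truncnS_gt.
have n2 : n.+1%:R <= 2 ^+ n :> R by rewrite -natrX ler_nat ltn_expl.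
have h0 := geometric_gt0 n.
rewrite -(ltr_pM2l (exprn_gt0 n (ltr0n R 2))) mulrCA geometricK mulr1.
apply: lt_le_trans cn _; by rewrite ler_wpM2r// ltW.
Qed.

Lemma complete_geometric_limit (u : nat -> M) c :
  complete_metric M -> (forall n k, mdist (u n) (u (n + k)%N) <= c * h n) ->
  exists l, forall n, mdist (u n) l <= c * h n.
Proof.
move=> hcomplete uc.
have [] := hcomplete (u @ \oo).
  apply: cauchy_exP => e e0; have [n cn] := geometric_small c e0; exists (u n).
  exists n => // m /= nm; rewrite ballEmdist/=.
  by rewrite (le_lt_trans _ cn)//; have := uc n (m - n)%N; rewrite subnKC.
move=> l ul; exists l => n; apply/ler_addgt0Pr => e e0.
have /metricType_numDomainType.cvgrPdist_lt /(_ e e0)[N _ HN] := ul.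
have := HN (n + N)%N (leq_addl _ _); rewrite /= metric_sym => lt.
have := metric_triangle (u n) (u (n + N)%N) l; have := uc n N; lra.
Qed.

(** Iterated approximate midpoints give points [a n k] for the parameters [k / 2 ^+ n]; the curve is
    the limit of the step functions [g_ n]. *)
Lemma dyadic_curve (p q : M) th : complete_metric M -> 0 < th ->
  (forall (u v : M) e, 0 < e -> exists w,
     mdist u w <= mdist u v / 2 + e /\ mdist w v <= mdist u v / 2 + e) ->
  exists g : R -> M, [/\ g 0 = p, g 1 = q &
    forall s t, 0 <= s -> 0 <= t -> mdist (g s) (g t) <= (mdist p q + th) * `|s - t|].
Proof.
move=> hcomplete th0 hmid.
have /choice[mid midP] : forall z : M * M * R, exists w, 0 < z.2 ->
    mdist z.1.1 w <= mdist z.1.1 z.1.2 / 2 + z.2 /\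
    mdist w z.1.2 <= mdist z.1.1 z.1.2 / 2 + z.2.
  move=> [[u v] e] /=; have [e0|_] := ltP 0 e; last by exists u.
  by have [w Hw] := hmid u v e e0; exists w.
set D := mdist p q; have D0 : 0 <= D := mdist_ge0 _ _.
pose L := D + th; have L0 : 0 <= L by rewrite addr_ge0// ltW.
(* The tolerance [th * h n ^+ 2] at level [n] raises the speed bound by exactly [th * h n], and
   these amounts sum to less than [th]. *)
pose fix a (n k : nat) {struct n} : M := if n is n'.+1 then
    (if odd k then mid (a n' k./2, a n' k./2.+1, th * h n ^+ 2) else a n' k./2)
  else if k is 0 then p else q.
have h_gt0 := geometric_gt0.
have step n k : mdist (a n k) (a n k.+1) <= (D + th * (1 - h n)) * h n.
  elim: n k => [|n IH] k.
    rewrite /h expr0 subrr mulr0 addr0 mulr1 /=.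
    by case: k => [|k] //=; rewrite mdistxx.
  have tol0 : 0 < th * h n.+1 ^+ 2 by rewrite mulr_gt0// exprn_gt0.
  have := midP (a n k./2, a n k./2.+1, th * h n.+1 ^+ 2) tol0.
  have := IH k./2; move: tol0; rewrite /= uphalf_half geometricS expr2.
  case: (odd k) => /=; rewrite ?add1n ?add0n; nra.
have stepL n k : mdist (a n k) (a n k.+1) <= L * h n.
  apply: le_trans (step n k) _; apply: ler_wpM2r; first exact: ltW.
  by rewrite /L lerD2l ler_piMr ?(ltW th0)// gerBl ltW.
have stepsL n k m : mdist (a n k) (a n (k + m)%N) <= m%:R * (L * h n).
  elim: m => [|m IH]; first by rewrite addn0 mdistxx mul0r.
  rewrite addnS -[m.+1]addn1 natrD mulrDl mul1r.
  rewrite (le_trans (metric_triangle _ (a n (k + m)%N) _))// lerD//.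
pose g_ n (t : R) := a n (Num.truncn (t * 2 ^+ n)).
have gS n t : 0 <= t -> mdist (g_ n t) (g_ n.+1 t) <= L * h n.+1.
  move=> t0; rewrite /g_; set m := Num.truncn (t * 2 ^+ n.+1).
  have y0 : 0 <= t * 2 ^+ n by rewrite mulr_ge0// exprn_ge0.
  (* Halving the index passes to the coarser grid, so consecutive approximations coincide or are
     neighbours at the finer level. *)
  have -> : Num.truncn (t * 2 ^+ n) = m./2.
    apply: truncn_def.
    have /truncn_itv : 0 <= t * 2 ^+ n.+1 by rewrite mulr_ge0// exprn_ge0.
    rewrite -/m exprS mulrCA -[in m%:R](odd_double_half m) -[in m.+1%:R](odd_double_half m).
    rewrite -addn1 -muln2 !natrD !natrM -[_.+1]addn1 natrD.
    by case: (odd m) => /= /andP[h1 h2]; apply/andP; split; lra.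
  rewrite /=; case: ifPn => [om|_]; last by rewrite mdistxx mulr_ge0// ltW.
  have := stepL n.+1 (m./2).*2; rewrite /= odd_double doubleK uphalf_double.
  done.
have gk n k t : 0 <= t -> mdist (g_ n t) (g_ (n + k)%N t) <= 2 * L * (h n - h (n + k)%N).
  move=> t0; elim: k => [|k IH]; first by rewrite addn0 mdistxx subrr mulr0.
  rewrite addnS (le_trans (metric_triangle _ (g_ (n + k)%N t) _))//.
  have := gS (n + k)%N t t0; rewrite geometricS.
  by have := mulr_ge0 L0 (ltW (h_gt0 (n + k)%N)); lra.
have /choice[g gP] : forall t, exists l, 0 <= t -> forall n, mdist (g_ n t) l <= 2 * L * h n.
  move=> t; have [t0|_] := leP 0 t; last by exists p.
  have [|l Hl] := @complete_geometric_limit (fun n => g_ n t) (2 * L) hcomplete.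
    move=> n k; rewrite (le_trans (gk n k t t0))// ler_wpM2l ?mulr_ge0//.
    by rewrite gerBl ltW.
  by exists l.
have pt (u v : M) c : 0 <= c -> (forall n, mdist u v <= c * h n) -> u = v.
  move=> c0 uv; apply: mdist_positivity; apply/eqP; rewrite eq_le mdist_ge0 andbT.
  rewrite leNgt; apply/negP => /(geometric_small c)[n]; have := uv n; lra.
have L20 : 0 <= 2 * L by rewrite mulr_ge0.
exists g; split.
- apply/esym; apply: (pt _ _ (2 * L)) => // n; have := gP 0 (lexx _) n.
  rewrite /g_ mul0r truncn0; congr (mdist _ _ <= _).
  by elim: n => [|n IH].
- apply/esym; apply: (pt _ _ (2 * L)) => // n; have := gP 1 ler01 n.
  rewrite /g_ mul1r -natrX natrK; congr (mdist _ _ <= _).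
  elim: n => [//|n IH]; rewrite /= oddX/= expnS mul2n doubleK; exact: IH.
move=> s t; wlog st : s t / s <= t.
  by move=> H s0 t0; case/orP: (le_total s t) => st; [exact: H|rewrite metric_sym distrC; exact: H].
move=> s0 t0; rewrite distrC ger0_norm ?subr_ge0// -/D -/L.
(* The factor 5: rounding to the grid costs [L * h n], and each of the two limits costs
   [2 * L * h n]. *)
apply/ler_addgt0Pr => e e0; have [n hn] := geometric_small (5 * L) e0.
have gst : mdist (g_ n s) (g_ n t) <= L * (t - s) + L * h n.
  rewrite /g_; set i := Num.truncn _; set j := Num.truncn _.
  have p2 : 0 < 2 ^+ n :> R by rewrite exprn_gt0.
  have /truncn_itv/andP[] : 0 <= s * 2 ^+ n by rewrite mulr_ge0// ltW.
  have /truncn_itv/andP[] : 0 <= t * 2 ^+ n by rewrite mulr_ge0// ltW.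
  rewrite -/i -/j => jt _ _ si.
  have ij : (i <= j)%N by rewrite le_truncn// ler_wpM2r// ltW.
  have := stepsL n i (j - i)%N; rewrite subnKC// => h1; apply: le_trans h1 _.
  rewrite natrB// mulrCA -mulrDr ler_wpM2l//.
  have hn0 := h_gt0 n; have E := geometricK n.
  rewrite -[i.+1]addn1 natrD in si.
  have <- : ((t - s) * 2 ^+ n + 1) * h n = t - s + h n.
    by rewrite mulrDl mul1r -mulrA E mulr1.
  by rewrite ler_wpM2r// ?ltW//; lra.
have := gP s s0 n; have := gP t t0 n; rewrite (metric_sym (g_ n s)) => h1 h2.
have := metric_triangle (g s) (g_ n s) (g t); have := metric_triangle (g_ n s) (g_ n t) (g t).
lra.
Qed.

End DyadicCurve.

(** * Injective Lipschitz curves of minimal constant *)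

Lemma ultra_fmap (T U : Type) (f : T -> U) (F : set_system T) :
  UltraFilter F -> UltraFilter (f @ F).
Proof.
move=> UF; split; first exact: fmap_proper_filter.
move=> G PG FG; apply/seteqP; split=> [A GA|]; last exact: FG.
have [//|FnA] := in_ultra_setVsetC (f @^-1` A) UF.
have /FG GnA : (f @ F) (~` A) by exact: FnA.
by have [x []] := filter_ex (filterI GA GnA).
Qed.

Section MinimalCurve.
Variables (R : realType) (M : metricType R).
Implicit Types (K : set M) (p q : M) (g : R -> M).

Definition lip_curve K p q (L : R) g :=
  [/\ g 0 = p, g 1 = q, forall s, K (g s) &
      forall s t, mdist (g s) (g t) <= L * `|s - t|].

Lemma mdist_small_eq (x y : M) : (forall e, 0 < e -> mdist x y <= e) -> x = y.
Proof.
move=> h; apply: mdist_positivity; apply/eqP; rewrite eq_le mdist_ge0 andbT.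
by apply/ler_addgt0Pr => e e0; rewrite add0r h.
Qed.

(** Compactness of [K] gives a limit at every parameter along one ultrafilter on the indices; such a
    pointwise limit keeps the endpoints and the Lipschitz bound. *)
Lemma lip_curve_limit K p q L : compact K ->
  (forall e, 0 < e -> exists g, lip_curve K p q (L + e) g) ->
  exists g, lip_curve K p q L g.
Proof.
rewrite compact_ultra => cK hL.
have /choice[gs gsP] : forall n : nat, exists g, lip_curve K p q (L + n.+1%:R^-1) g.
  by move=> n; apply: hL; rewrite invr_gt0 ltr0n.
have [U [UU oU]] := ultraFilterLemma (_ : ProperFilter (\oo : set_system nat)).
have /choice[g gP] : forall s, exists x, K x /\ (gs^~ s) @ U --> x.
  move=> s; have UK : ((gs^~ s) @ U) K.
    by suff : U [set n | K (gs n s)] by []; apply: filterE => n; have [_ _ Kn _] := gsP n; exact: Kn.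
  by have [x [Kx ux]] := cK _ (ultra_fmap (gs^~ s) UU) UK; exists x.
have near_g s e : 0 < e -> U [set n | mdist (g s) (gs n s) < e].
  by move=> e0; have [_ /metricType_numDomainType.cvgrPdist_lt/(_ _ e0)] := gP s.
have fixed s x : (forall n, gs n s = x) -> g s = x.
  move=> gx; apply: mdist_small_eq => e e0.
  have [n] := filter_ex (near_g s _ e0); rewrite /= gx; exact: ltW.
exists g; split=> [|||s t].
- by apply: fixed => n; have [] := gsP n.
- by apply: fixed => n; have [] := gsP n.
- by move=> s; have [] := gP s.
apply/ler_addgt0Pr => e e0; have e3 : 0 < e / 3 by rewrite divr_gt0.
pose N := Num.truncn (`|s - t| / (e / 3)).
have UN : U [set n | (N <= n)%N] by apply: oU; exact: nbhs_infty_ge.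
have [n [[h1 h2] /= Nn]] := filter_ex (filterI (filterI (near_g s _ e3) (near_g t _ e3)) UN).
have [_ _ _ /(_ s t) h3] := gsP n.
have h4 : n.+1%:R^-1 * `|s - t| <= e / 3.
  rewrite mulrC ler_pdivrMr ?ltr0n// mulrC -ler_pdivrMr//.
  by rewrite (le_trans (ltW (truncnS_gt _)))// ler_nat.
have := metric_triangle (g s) (gs n s) (g t).
have := metric_triangle (gs n s) (gs n t) (g t).
rewrite (metric_sym (gs n t)); move: h1 h2 => /=.
by move: h3 h4; rewrite mulrDl; move: (_^-1 * _) => z; lra.
Qed.

(** The map [phi] jumps over the loop on [[s, t]], and the remaining time [1 - (t - s)] is stretched
    back to 1. *)
Lemma lip_curve_cut K p q L g s t : 0 <= L -> 0 <= s -> s < t -> t <= 1 ->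
  lip_curve K p q L g -> g s = g t ->
  exists g', lip_curve K p q (L * (1 - (t - s))) g'.
Proof.
move=> L0 s0 st t1 [gp gq gK gL] gst; set d := t - s.
have d0 : 0 < d by rewrite subr_gt0.
have d1 : 0 <= 1 - d by rewrite /d; lra.
pose phi x := if x <= s then x else x + d.
have gphi x y : x <= y -> mdist (g (phi x)) (g (phi y)) <= L * (y - x).
  move=> xy; rewrite /phi; case: ifPn => [xs|]; case: ifPn => [ys|]; rewrite -?ltNge.
  - by rewrite (le_trans (gL _ _))// distrC ger0_norm ?subr_ge0.
  - move=> sy; rewrite (le_trans (metric_triangle _ (g s) _))// {2}gst.
    have := gL x s; have := gL t (y + d).
    rewrite (distrC x) (distrC t) !ger0_norm ?subr_ge0//; last by rewrite /d; lra.
    by move=> h1 h2; rewrite (le_trans (lerD h2 h1))// /d; lra.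
  - by move=> sx; have := lt_le_trans sx (le_trans xy ys); rewrite ltxx.
  - by move=> _; rewrite (le_trans (gL _ _))// distrC ger0_norm /d; lra.
(* When [t = 1], the time [1 - d] equals [s] and lies before the jump; the endpoint is then
   [g s = g t = q]. *)
have phi1 : g (phi (1 - d)) = q.
  rewrite /phi; case: ifPn => [h|_]; last by rewrite subrK.
  have t1' : t = 1 by apply/eqP; rewrite eq_le t1 -subr_ge0; move: h; rewrite /d; lra.
  have -> : 1 - d = s by rewrite /d t1'; ring.
  by rewrite gst t1'.
exists (fun r => g (phi (r * (1 - d)))); split=> [|||x y].
- by rewrite mul0r /phi s0.
- by rewrite mul1r.
- by move=> x; exact: gK.
wlog xy : x y / x <= y.
  by move=> H; case/orP: (le_total x y) => ?; [exact: H|rewrite metric_sym distrC; exact: H].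
have := gphi (x * (1 - d)) (y * (1 - d)) (ler_wpM2r d1 xy).
by rewrite distrC ger0_norm ?subr_ge0// -mulrBl -mulrA [(1 - d) * _]mulrC.
Qed.

(* Cutting out a loop strictly lowers the Lipschitz constant, so a curve of
   minimal constant is injective. *)
Lemma minimal_lip_curve K p q L g : compact K -> p <> q -> lip_curve K p q L g ->
  exists L' g', [/\ L' <= L, lip_curve K p q L' g' &
    {in `[0, 1] &, injective g'}].
Proof.
move=> cK pq gL.
pose A := [set L' | exists g', lip_curve K p q L' g'].
have AD L' : A L' -> mdist p q <= L'.
  by move=> [g' [<- <- _ /(_ 0 1)]]; rewrite sub0r normrN normr1 mulr1.
have D0 : 0 < mdist p q by rewrite mdist_gt0; exact/eqP.
have Ainf : has_inf A by split; [exists L, g|exists (mdist p q) => x /AD].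
have Ale x : A x -> inf A <= x by apply: ge_inf; case: Ainf.
have infD : mdist p q <= inf A by apply: lb_le_inf; [exact: Ainf.1|move=> x /AD].
have [g' g'L] : exists g', lip_curve K p q (inf A) g'.
  apply: lip_curve_limit => // e e0.
  have [L' [g' [g1 g2 g3 g4]] L'e] := inf_adherent e0 Ainf.
  exists g'; split=> // s t; rewrite (le_trans (g4 s t))// ler_wpM2r//; exact: ltW.
exists (inf A), g'; split=> //; first by apply: Ale; exists g.
have noloop s t : 0 <= s -> s < t -> t <= 1 -> g' s <> g' t.
  move=> s0 st t1 gst.
  have A0 : 0 <= inf A by rewrite (le_trans _ infD)// ltW.
  have /Ale := lip_curve_cut A0 s0 st t1 g'L gst.
  apply/negP; rewrite -ltNge gtr_pMr; first lra.
  exact: lt_le_trans infD.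
move=> s t; rewrite !in_itv/= => /andP[s0 s1] /andP[t0 t1] gst.
case: (ltgtP s t) => // st; first by have := noloop _ _ s0 st t1 gst.
by have := noloop _ _ t0 st s1 (esym gst).
Qed.

Lemma lipschitz_curve_continuous L g :
  (forall s t, mdist (g s) (g t) <= L * `|s - t|) -> continuous g.
Proof.
move=> gL x; apply/metricType_numDomainType.cvgrPdist_lt => e e0.
have L1 : 0 < `|L| + 1 by rewrite ltr_wpDl.
near=> y; rewrite (le_lt_trans (gL _ _))//.
apply: (@le_lt_trans _ _ ((`|L| + 1) * `|x - y|)).
  by rewrite ler_wpM2r// (le_trans (ler_norm _))// lerDl.
rewrite -ltr_pdivlMl// mulrC; near: y.
by apply: cvgr_dist_lt; [exact: cvg_id|rewrite divr_gt0].
Unshelve. all: by end_near. Qed.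

Lemma lip_curve_length L g : 0 <= L ->
  (forall s t, mdist (g s) (g t) <= L * `|s - t|) ->
  (path_length 0 1 g <= L%:E)%E.
Proof.
move=> L0 gL; apply: ge_ereal_sup => _ [n [t [t0 t1 tm ->]]]; rewrite lee_fin.
apply: (@le_trans _ _ (\sum_(i < n) L * (t i.+1 - t i))).
  apply: ler_sum => i _; rewrite (le_trans (gL _ _))// distrC ger0_norm//.
  by rewrite subr_ge0 tm.
rewrite -mulr_sumr -(big_mkord xpredT (fun i => t i.+1 - t i)) telescope_sumr//.
by rewrite t0 t1 subr0 mulr1.
Qed.

Lemma complete_midpoints_length_space : complete_metric M ->
  (forall (u v : M) e, 0 < e -> exists w,
     mdist u w <= mdist u v / 2 + e /\ mdist w v <= mdist u v / 2 + e) ->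
  length_space M.
Proof.
move=> hcomplete hmid p q pq; apply/eqP; rewrite eq_le; apply/andP; split.
  apply: le_ereal_inf_tmp => _ [a [b [g [[ab _ ga gb] _ _ ->]]]].
  have := @path_length_ge _ _ a b g 1%N (fun n => if n is 0 then a else b) erefl erefl.
  by rewrite big_ord1 /= ga gb; apply; case.
apply/lee_addgt0Pr => th th0; rewrite -EFinD.
have [g0 [g00 g01 g0L]] := dyadic_curve p q hcomplete th0 hmid.
pose clamp (t : R) := Num.max 0 (Num.min t 1).
have clamp01 t : 0 <= clamp t <= 1.
  by rewrite /clamp /Num.max /Num.min; do 2 case: ifPn; rewrite -?leNgt; lra.
have clampL s t : `|clamp s - clamp t| <= `|s - t|.
  rewrite /clamp /Num.max /Num.min; do 4 case: ifPn; rewrite -?leNgt => *;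
    by case: (ger0P (s - t)); rewrite ?ler_norml; lra.
set L := mdist p q + th in g0L *.
have L0 : 0 <= L by rewrite addr_ge0 ?mdist_ge0// ltW.
pose g1 := g0 \o clamp.
have g1L s t : mdist (g1 s) (g1 t) <= L * `|s - t|.
  have /andP[s0 _] := clamp01 s; have /andP[t0 _] := clamp01 t.
  by rewrite (le_trans (g0L _ _ s0 t0))// ler_wpM2l.
(* [M] need not be compact, but the image of one almost optimal curve is; the minimisation takes
   place inside it. *)
pose K := g1 @` `[0, 1].
have cK : compact K.
  apply: continuous_compact; last exact: segment_compact.
  apply: continuous_subspaceT; exact: lipschitz_curve_continuous g1L.
have clampK t : 0 <= t <= 1 -> clamp t = t.
  by rewrite /clamp /Num.max /Num.min => /andP[? ?]; do 2 case: ifPn; rewrite -?leNgt; lra.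
have g1c : lip_curve K p q L g1.
  split=> // [||s].
  - by rewrite /g1 /= clampK// lexx ler01.
  - by rewrite /g1 /= clampK// lexx ler01.
  - exists (clamp s); first by rewrite /= in_itv/=.
    by rewrite /g1 /= clampK.
have [L' [g [L'L [gp gq _ gL] ginj]]] := minimal_lip_curve cK pq g1c.
have L'0 : 0 <= L'.
  have := gL 0 1; rewrite gp gq sub0r normrN normr1 mulr1; apply: le_trans.
  exact: mdist_ge0.
have glen := lip_curve_length L'0 gL.
apply: (@le_trans _ _ (path_length 0 1 g)).
  apply: ereal_inf_lbound; exists 0, 1, g; split=> //.
    split=> //; apply: continuous_subspaceT; exact: lipschitz_curve_continuous gL.
  exact: le_lt_trans glen (ltry _).
by rewrite (le_trans glen)// lee_fin.
Qed.

End MinimalCurve.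

(** * Chains with short steps *)

Section Walks.
Variables (R : realType) (M : metricType R).

Inductive walk (P : M -> M -> Prop) (c : M -> M -> R) : M -> M -> R -> Prop :=
| walk0 u : walk P c u u 0
| walkS u v w r : P u v -> walk P c v w r -> walk P c u w (c u v + r).

Lemma walk_cat P c u v w r r' : walk P c u v r -> walk P c v w r' ->
  walk P c u w (r + r').
Proof.
elim=> {u v r} [u|u v x r Puv _ IH] vw; first by rewrite add0r.
by rewrite -addrA; apply: walkS => //; exact: IH.
Qed.

Lemma walk_ge P c a u v r : 0 <= a -> (forall x y, a * mdist x y <= c x y) ->
  walk P c u v r -> a * mdist u v <= r.
Proof.
move=> a0 ac; elim=> {u v r} [u|u v w r _ _ IH]; first by rewrite mdistxx mulr0.
have := ler_wpM2l a0 (metric_triangle u v w); have := ac u v; lra.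
Qed.

Definition short_chain (s : R) := walk (fun x y => mdist x y <= s) mdist.

Definition chainable s u v := forall e, 0 < e ->
  exists2 r, short_chain s u v r & r <= mdist u v + e.

(** Follow the chain until the next step would exceed the budget [a]; stopping there wastes less
    than one step, hence the term [s]. The maximum with 0 covers a chain that ends within the
    budget. *)
Lemma short_chain_split s u v r a : short_chain s u v r -> 0 <= a ->
  exists w, mdist u w <= a /\ mdist w v <= Num.max 0 (r - a + s).
Proof.
move=> uv; elim: uv a => {u v r} [u|u v w r us vw IH] a a0.
  by exists u; rewrite mdistxx le_max lexx.
have [uva|auv] := leP (mdist u v) a.
  have [|x [vx xw]] := IH (a - mdist u v); first by rewrite subr_ge0.
  exists x; split; first by have := metric_triangle u v x; lra.
  by move: xw; rewrite opprB addrCA addrA.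
exists u; rewrite mdistxx; split=> //; rewrite le_max; apply/orP; right.
have vwr : 1 * mdist v w <= r by apply: walk_ge vw => // x y; rewrite mul1r.
have := metric_triangle u v w; lra.
Qed.

Lemma chainable_midpoint : (forall s u v, 0 < s -> chainable s u v) ->
  forall (u v : M) e, 0 < e -> exists w,
     mdist u w <= mdist u v / 2 + e /\ mdist w v <= mdist u v / 2 + e.
Proof.
move=> ch u v e e0; have e2 : 0 < e / 2 by rewrite divr_gt0.
have d0 := mdist_ge0 u v.
have [r uvr rd] := ch _ u v e2 _ e2.
have [|w [uw wv]] := @short_chain_split (e / 2) u v r (mdist u v / 2) uvr; first lra.
exists w; split; first lra.
by apply: le_trans wv _; rewrite ge_max; apply/andP; split; lra.
Qed.

End Walks.

(** * Discounted walks and the gap of a non-chainable pair *)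

Section DiscountedWalks.
Variables (R : realType) (M : metricType R) (s : R) (p q : M) (k : R).
Local Notation D := (mdist p q).

Definition near_pq u v := (mdist u p <= D / 16) && (mdist v q <= D / 16).

(* Steps are discounted by the factor [1 - t], except those that go almost
   directly from [p] to [q]. *)
Definition discounted t u v : R :=
  if near_pq u v then mdist u v else (1 - t) * mdist u v.

Lemma discounted_ge t u v : 0 <= t -> (1 - t) * mdist u v <= discounted t u v.
Proof.
by rewrite /discounted; case: ifP => // _ t0; rewrite ler_piMl ?mdist_ge0//; lra.
Qed.

Lemma discounted_le t u v : 0 <= t -> discounted t u v <= mdist u v.
Proof.
by rewrite /discounted; case: ifP => // _ t0; rewrite ler_piMl ?mdist_ge0//; lra.
Qed.

(** Induction on the walk: around a distinguished step the triangle inequality collapses the rest;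
    if there is none, every step is chainable and the short chains are concatenated. *)
Lemma discounted_walk_cases t u v r : 0 <= t <= 1 ->
  walk (fun _ _ => True) (discounted t) u v r ->
  [\/ exists x y, near_pq x y /\
        (1 - t) * mdist u x + mdist x y + (1 - t) * mdist y v <= r,
      exists x y, [/\ ~~ near_pq x y, ~ chainable s x y &
        (1 - t) * (mdist u x + mdist x y + mdist y v) <= r] |
      forall e, 0 < e -> exists2 r', short_chain s u v r' & (1 - t) * r' <= r + e].
Proof.
move=> /andP[t0 t1].
have t1' : 0 <= 1 - t by rewrite subr_ge0.
have dge x y := discounted_ge x y t0.
elim=> {u v r} [u|u v w r _ vw IH].
  by apply: Or33 => e e0; exists 0; [exact: walk0|rewrite mulr0 add0r ltW].
have vwr := walk_ge t1' dge vw; have duv := dge u v.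
have [nuv|nuv] := boolP (near_pq u v).
  apply: Or31; exists u, v; split=> //.
  by rewrite mdistxx mulr0 add0r /discounted nuv lerD2l.
have [cuv|cuv] := pselect (chainable s u v); last first.
  apply: Or32; exists u, v; split=> //.
  by rewrite mdistxx add0r mulrDr lerD.
case: IH => [[x [y [nxy xyr]]]|[x [y [nxy cxy xyr]]]|ch].
- apply: Or31; exists x, y; split=> //.
  by have := ler_wpM2l t1' (metric_triangle u v x); lra.
- apply: Or32; exists x, y; split=> //.
  by have := ler_wpM2l t1' (metric_triangle u v x); lra.
apply: Or33 => e e0; have e2 : 0 < e / 2 by rewrite divr_gt0.
have [r1 uvr1 r1d] := cuv _ e2; have [r2 vwr2 r2r] := ch _ e2.
exists (r1 + r2); first exact: walk_cat uvr1 vwr2.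
have := ler_wpM2l t1' r1d; have : (1 - t) * (e / 2) <= e / 2.
  by apply: ler_piMl; [exact: ltW|lra].
lra.
Qed.

(** With a [near_pq] step, at most [D / 8] is discounted, which loses at most [t * D / 8]. In the
    other cases the undiscounted length is at least [D + m], up to an arbitrarily small error, and
    [t] discounts this to [D]: a non-chainable step has length at least [32 / 33 * D], the detour to
    it is at least [D / 16], and [32 / 33 + 1 / 16 > 33 / 32]. *)
Lemma discounted_walk_ge t m r : 0 < D -> 0 < m -> m <= k -> 32 * m <= D ->
  0 <= t <= 1 -> (1 - t) * (D + m) = D ->
  (forall r, short_chain s p q r -> D + k < r) ->
  (forall u v : M, ~ chainable s u v -> D <= (1 + 32^-1) * mdist u v) ->
  walk (fun _ _ => True) (discounted t) p q r -> D * (1 - t / 8) <= r.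
Proof.
move=> D0 m0 mk mD t01 tm pqk bad pqr; have /andP[t0 t1] := t01.
have t1' : 0 <= 1 - t by rewrite subr_ge0.
have Dt : 0 <= D * t by rewrite mulr_ge0// ltW.
case: (discounted_walk_cases t01 pqr) => [[x [y [/andP[xp yq] h]]]|[x [y [nxy cxy h]]]|ch].
- have h1 := metric_triangle p x q; have h2 := metric_triangle x y q.
  have := ler_wpM2l t0 xp; have := ler_wpM2l t0 yq.
  rewrite (metric_sym x) in xp *; lra.
- have Dr : D <= r.
    rewrite -tm (le_trans _ h)// ler_wpM2l//.
    have := bad _ _ cxy; have := mdist_ge0 p x; have := mdist_ge0 y q.
    move: nxy; rewrite /near_pq negb_and (metric_sym x) -!ltNge => /orP[]; lra.
  lra.
have Dr : D <= r.
  apply/ler_addgt0Pr => e e0; have [r' pqr' r'r] := ch e e0.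
  have := ler_wpM2l t1' (ltW (pqk _ pqr')); have := ler_wpM2l t1' mk; lra.
lra.
Qed.

End DiscountedWalks.

(* [f] stands for the cheapest discounted cost of reaching [q]. Any [g] that nearly
   norms the almost-square companion [y] of the molecule of [(p, q)] is almost
   constant on [{p, q}], so [f + t g] has a smaller Lipschitz constant than the
   value of [x + y] at it allows. *)
Lemma almost_square_no_gap (R : realType) (M : metricType R) (x0 p q : M) t
    (f : M -> R) : 0 < mdist p q -> 0 < t <= 1 ->
  locally_almost_square (free_space x0) ->
  lip1 f -> (forall u v, ~~ near_pq p q u v -> f u - f v <= (1 - t) * mdist u v) ->
  mdist p q * (1 - t / 8) <= f p - f q -> False.
Proof.
set D := mdist p q.
move=> D0 /andP[t0 t1] lasq lf fnear fpq.
pose x : free_space x0 := D^-1 *: (free_delta x0 p - free_delta x0 q).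
have evx g : is_lipschitz g -> ev x g = (g p - g q) / D.
  by move=> lg; rewrite /x evZ evB !ev_delta// mulrC; congr (_ / _); ring.
have D1 : D^-1 * D = 1 by rewrite mulVf// gt_eqF.
have x1 : `|x| = 1.
  apply/eqP; rewrite eq_le; apply/andP; split.
    apply: norm_le => // g lg; rewrite evx; last exact: lip1_lipschitz.
    by rewrite ler_pdivrMr// mul1r.
  have ld : lip1 (mdist^~ q).
    by move=> u v; have := metric_triangle u v q; lra.
  have := ev_le1 x ld; rewrite evx; last exact: lip1_lipschitz.
  by rewrite mdistxx subr0 divff ?gt_eqF// normr1.
clearbody x; pose e := t / 100; have e0 : 0 < e by rewrite divr_gt0.
have [y [y1 xy1 xy2]] := lasq e x e0 x1.
have [g lg] := norm_ev y e0; rewrite y1 => yg.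
have lipg := lip1_lipschitz lg; have lipf := lip1_lipschitz lf.
have B (u : free_space x0) h L : 0 <= L -> lipschitz_with L h -> `|u| <= 1 + e ->
    - ((1 + e) * L) <= ev u h <= (1 + e) * L.
  move=> L0 Lh u1; rewrite -ler_norml (le_trans (ev_le u L0 Lh))//.
  by rewrite ler_wpM2r.
have [/lip1P l1g /lip1P l1f] := (lg, lf).
have /andP[_ h1] := B _ _ _ ler01 l1g xy1.
have /andP[h2 _] := B _ _ _ ler01 l1g xy2.
have /andP[_ h3] := B _ _ _ ler01 l1f xy2.
rewrite evD in h1; rewrite evB in h2; rewrite evB in h3.
have xg : ev x g * D = g p - g q by rewrite evx// divfK// gt_eqF.
have xf : 1 - t / 8 <= ev x f by rewrite evx// ler_pdivlMr// mulrC.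
(* [g] nearly attains the norm of [y], so the bound on [x + y] leaves at most [2 * e] for [x]. *)
have gpq : g p - g q <= 2 * e * D.
  rewrite -xg; apply: ler_wpM2r; [exact: ltW|].
  by move: h1 yg; move: (ev x g) (ev y g) => a b; clear; lra.
(* Off [near_pq] the two terms give [t + (1 - t)]; on [near_pq] the increment of [g] is at most half
   the distance, which gives [1 + t / 2]. *)
pose L := 1 + t / 2.
have LPhi : lipschitz_with L (fun z => t * g z + f z).
  move=> u v; have [/andP[up vq]|nuv] := boolP (near_pq p q u v); last first.
    have := fnear _ _ nuv; have := ler_wpM2l (ltW t0) (lg u v).
    have := mulr_ge0 (ltW t0) (mdist_ge0 u v); rewrite /L.
    move: (mdist u v) (f u) (f v) (g u) (g v); clear; move=> *; lra.
  have guv : g u - g v <= mdist u v / 2.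
    have tD : t * D <= D by rewrite ler_piMl// ltW.
    have := lg u p; have := lg q v; rewrite (metric_sym q v).
    have := metric_triangle p u q; have := metric_triangle u v q.
    rewrite (metric_sym p u) -/D; move: up vq gpq tD D0; rewrite -/D /e.
    by clear; lra.
  by have := ler_wpM2l (ltW t0) guv; have := lf u v; rewrite /L; clear; lra.
have L0 : 0 <= L by rewrite addr_ge0// divr_ge0// ltW.
(* The value of [x + y] is at least [1 + 3 * t / 4 - e - 3 * t * e], while the bound is
   [(1 + e) * (1 + t / 2)]; for [e = t / 100] these are incompatible. *)
have /andP[_] := B _ _ _ L0 LPhi xy1.
rewrite ev_lin// evD evD.
have xg2 : - (2 * e) <= ev x g by move: h2 yg; move: (ev x g) (ev y g) => a b; clear; lra.
move: xg2 xf h3 yg; rewrite /L /e; move: (ev x g) (ev y g) (ev x f) (ev y f) t0 t1.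
clear; move=> a b c d t0 t1; nra.
Qed.

(** By contradiction, with a non-chainable pair of almost minimal distance. Such distances are at
    least [s], because closer points are joined by a single step. *)
Lemma locally_almost_square_chainable (R : realType) (M : metricType R) (x0 : M)
    s (u v : M) :
  locally_almost_square (free_space x0) -> 0 < s -> chainable s u v.
Proof.
move=> lasq s0; apply: contrapT => uv.
pose B := [set r | exists u v : M, ~ chainable s u v /\ r = mdist u v].
have Bs r : B r -> s <= r.
  move=> [a [b [ab ->]]]; rewrite leNgt; apply/negP => dab; apply: ab => e e0.
  exists (mdist a b + 0); last by rewrite addr0 lerDl ltW.
  by apply: walkS; [exact: ltW|exact: walk0].
have B0 : B !=set0 by exists (mdist u v), u, v.
have infB : 0 < inf B by apply: lt_le_trans s0 _; exact: lb_le_inf.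
have e32 : 0 < inf B / 32 by rewrite divr_gt0.
have [_ [p [q [pq ->]]] pqB] := inf_adherent e32 (conj B0 (ex_intro _ s Bs)).
have bad (a b : M) : ~ chainable s a b -> mdist p q <= (1 + 32^-1) * mdist a b.
  move=> ab; have : inf B <= mdist a b by apply: (le_inf_elt Bs); exists a, b.
  by move: pqB; lra.
have D0 : 0 < mdist p q by apply: lt_le_trans s0 _; apply: Bs; exists p, q.
have [k k0 pqk] : exists2 k, 0 < k & forall r, short_chain s p q r -> mdist p q + k < r.
  apply: contrapT => nk; apply: pq => e e0; apply: contrapT => nr.
  apply: nk; exists e => // r pqr; rewrite ltNge; apply/negP => re.
  by apply: nr; exists r.
pose m := Num.min k (mdist p q / 32).
have [m0 mk mD] : [/\ 0 < m, m <= k & 32 * m <= mdist p q].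
  by rewrite /m /Num.min; case: ifPn; rewrite -?leNgt; split; lra.
clearbody m; have Dm : 0 < mdist p q + m by rewrite addr_gt0.
(* The solution of [(1 - t) * (mdist p q + m) = mdist p q]. *)
pose t := m / (mdist p q + m).
have t0 : 0 < t by rewrite divr_gt0.
have t1 : t <= 1 by rewrite ler_pdivrMr// mul1r lerDr ltW.
have tm : (1 - t) * (mdist p q + m) = mdist p q.
  by rewrite mulrBl mul1r divfK ?gt_eqF// addrK.
clearbody t.
pose W x := [set r | walk (fun _ _ => True) (discounted p q t) x q r].
have W0 x r : W x r -> 0 <= r.
  move=> xr; rewrite -(mul0r (mdist x q)); apply: walk_ge xr => // a b.
  rewrite mul0r (le_trans _ (discounted_ge p q a b (ltW t0)))//.
  by rewrite mulr_ge0 ?mdist_ge0// subr_ge0.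
have Wne x : W x !=set0.
  by exists (discounted p q t x q + 0); apply: walkS => //; exact: walk0.
pose f x := inf (W x).
(* Prepending one step to a walk yields both Lipschitz bounds on [f], the plain and the discounted
   one. *)
have fle x y : f x <= discounted p q t x y + f y.
  rewrite -lerBlDl; apply: lb_le_inf => // r yr; rewrite lerBlDl.
  by apply: (le_inf_elt (W0 x)); exact: walkS.
apply: (@almost_square_no_gap R M x0 p q t f) => //.
- by rewrite t0.
- move=> x y; have := fle x y; have := discounted_le p q x y (ltW t0); lra.
- move=> x y nxy; have := fle x y; rewrite /discounted (negbTE nxy); lra.
have fq : f q <= 0 by apply: (le_inf_elt (W0 q)); exact: walk0.
have : mdist p q * (1 - t / 8) <= f p.
  apply: lb_le_inf => // r pr.
  by apply: (discounted_walk_ge D0 m0 mk mD _ tm pqk bad pr); rewrite ltW.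
move: fq; lra.
Qed.

Theorem theorem3p1 (R : realType) (M : metricType R) (x0 : M)
    (hcomplete : complete_metric M) (hM : exists p q : M, p <> q) :
  locally_almost_square (free_space x0) <-> length_space M.
Proof.
split=> [lasq|]; last exact: length_space_locally_almost_square.
apply: complete_midpoints_length_space => //; apply: chainable_midpoint => s u v s0.
exact: locally_almost_square_chainable lasq s0.
Qed.
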